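(* Let $(Z_i^{(1)})_{i\ge1}$ and $(Z_i^{(2)})_{i\ge1}$ be two mutually independent sequences, each consisting of i.i.d. random vectors in $\mathbb{R}^2$ (the two laws may differ), with $\mathbb{E}[\|Z_1^{(k)}\|^2]<\infty$ for $k=1,2$. Assume that $\boldsymbol{0}\notin\{\boldsymbol{\mu}^{(1)},\boldsymbol{\mu}^{(2)},\boldsymbol{\mu}^{(1)}-\boldsymbol{\mu}^{(2)}\}$ and that $\|\boldsymbol{\mu}^{(1)}\|$ is the unique maximal element among $\|\boldsymbol{\mu}^{(1)}\|,\|\boldsymbol{\mu}^{(2)}\|,\|\boldsymbol{\mu}^{(1)}-\boldsymbol{\mu}^{(2)}\|$, i.e. $\|\boldsymbol{\mu}^{(1)}\|>\max\{\|\boldsymbol{\mu}^{(2)}\|,\|\boldsymbol{\mu}^{(1)}-\boldsymbol{\mu}^{(2)}\|\}$. Then, as $n\to\infty$, $$n^{-1/2}\left|D_n-\mathbb{E}D_n-\left(S_n^{(1)}-\mathbb{E}S_n^{(1)}\right)\cdot\mathbf{e}_{\theta^{(1)}}\right|\longrightarrow0\quad\text{in }L^2.$$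
   Context: $\boldsymbol{\mu}^{(k)}=\mathbb{E}[Z_1^{(k)}]$, $S_0^{(k)}=0$, $S_n^{(k)}=\sum_{i=1}^n Z_i^{(k)}$ for $k=1,2$. $D_n$ is the diameter of the convex hull of $\{S_j^{(k)}:0\le j\le n,\ k=1,2\}$. $\mathbf{e}_\theta=(\cos\theta,\sin\theta)$, and $\theta^{(1)}\in[0,2\pi)$ is given by $\boldsymbol{\mu}^{(1)}=\|\boldsymbol{\mu}^{(1)}\|\,\mathbf{e}_{\theta^{(1)}}$. Here $\cdot$ is the Euclidean scalar product and $\|\cdot\|$ the Euclidean norm. *)

(* Defs.v *)
From HB Require Import structures.
From mathcomp Require Import all_boot all_order all_algebra finmap.
From mathcomp Require Import all_classical all_reals all_analysis.

Set Implicit Arguments.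
Unset Strict Implicit.
Unset Printing Implicit Defensive.

Import Order.TTheory GRing.Theory Num.Theory.
Import numFieldNormedType.Exports.

Local Open Scope classical_set_scope.
Local Open Scope ring_scope.

(* Vectors of R^2 are pairs: [R * R] carries the product sigma-algebra of the
   Borel sets of R. Its library norm is the sup norm, hence [enorm]. *)

Definition dot (R : realType) (u v : R * R) : R := u.1 * v.1 + u.2 * v.2.

Definition enorm (R : realType) (u : R * R) : R := Num.sqrt (dot u u).

Definition unit_dir (R : realType) (theta : R) : R * R := (cos theta, sin theta).

Definition convex_hull (R : realType) (A : set (R * R)) : set (R * R) :=
  smallest (@convex_set R (R * R)%type) A.

Definition diameter (R : realType) (A : set (R * R)) : R :=
  sup [set enorm (x.1 - x.2) | x in A `*` A].

Definition vexpectation (d : measure_display) (T : measurableType d)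
    (R : realType) (P : probability T R) (X : T -> R * R) : R * R :=
  (fine 'E_P[fun w => (X w).1], fine 'E_P[fun w => (X w).2]).

Definition mutually_independent (d d' : measure_display) (T : measurableType d)
    (T' : measurableType d') (R : realType) (P : probability T R)
    (I : choiceType) (X : I -> {RV P >-> T'}) : Prop :=
  forall (J : {fset I}) (A : I -> set T'),
    (forall i, i \in J -> measurable (A i)) ->
    P (\bigcap_(i in [set` J]) (X i @^-1` A i)) =
    (\prod_(i <- J) P (X i @^-1` A i))%E.

Definition identically_distributed (d d' : measure_display)
    (T : measurableType d) (T' : measurableType d') (R : realType)
    (P : probability T R) (I : Type) (X : I -> {RV P >-> T'}) : Prop :=
  forall (i j : I) (A : set T'), measurable A ->
    distribution P (X i) A = distribution P (X j) A.

Definition iid (d d' : measure_display) (T : measurableType d)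
    (T' : measurableType d') (R : realType) (P : probability T R)
    (I : choiceType) (X : I -> {RV P >-> T'}) : Prop :=
  mutually_independent X /\ identically_distributed X.

Definition generated_sigma (d d' : measure_display) (T : measurableType d)
    (T' : measurableType d') (R : realType) (P : probability T R)
    (I : Type) (X : I -> {RV P >-> T'}) : set (set T) :=
  <<s \bigcup_i preimage_set_system setT (X i) measurable >>.

Definition independent_families (d d' : measure_display) (T : measurableType d)
    (T' : measurableType d') (R : realType) (P : probability T R)
    (I : Type) (X Y : I -> {RV P >-> T'}) : Prop :=
  forall A B : set T, generated_sigma X A -> generated_sigma Y B ->
    P (A `&` B) = (P A * P B)%E.

(* The step [Z_i] of the walk, i >= 1, is [Z i.-1]: [walk Z n] sums the first
   [n] steps. *)
Definition walk (T : Type) (R : realType) (Z : nat -> T -> R * R) (n : nat)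
    (w : T) : R * R := \sum_(i < n) Z i w.

Definition walks_diameter (T : Type) (R : realType) (Z1 Z2 : nat -> T -> R * R)
    (n : nat) (w : T) : R :=
  diameter (convex_hull ([set walk Z1 j w | j in [set j | (j <= n)%N]] `|`
                         [set walk Z2 j w | j in [set j | (j <= n)%N]])).

Definition converges_in_L2 (d : measure_display) (T : measurableType d)
    (R : realType) (P : probability T R) (X : nat -> T -> R) (Y : T -> R) :
    Prop :=
  (forall n, X n \in Lfun P 2%:E) /\ Y \in Lfun P 2%:E /\
  (Lnorm P 2%:E (fun w => (X n w - Y w)%:E) @[n --> \oo] --> 0%E).

(* Main.v *)
(* Write X_n = S_n^(1) . e_theta1. It suffices to show E (D_n - X_n)^2 = o(n),
   since centering can only decrease a second moment.

   A pair of points of the two walks realises the vector j mu^(k) - i mu^(l)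
   up to the fluctuations of the centered walks. By maximality of |mu^(1)|,
   the length of this vector falls short of n |mu^(1)| by at least a fixed
   multiple dlt of the number c = (n - j) + i of steps by which the pair misses
   the extreme pair (S_0, S_n^(1)). If c > k, the loss k dlt beats the
   fluctuations M unless 3 M > k dlt. If c <= k, the pair is compared with
   the vector S_n^(1) itself, at the price of the fluctuations Q of the walks
   over windows of k steps. Hence 0 <= D_n - X_n <=
   2 Q + 2 (k / n) M + 6 (M - k dlt / 6)_+. With k of order n / q, Doob's L^2
   inequality bounds E Q^2 by C n / q and E M^2 by C n, and the
   same inequality for the overshoot over the level c n, followed by a one-step
   expansion of (x - c n)_+^2, gives E (M - c n)_+^2 = o(n) for every c > 0. *)

Require Import Defs.
From mathcomp Require Import all_boot all_order all_algebra.
From mathcomp Require Import finmap.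
From mathcomp Require Import all_classical all_reals all_analysis.
From mathcomp Require Import measurable_realfun.
From mathcomp Require Import ring lra.

Import Order.TTheory GRing.Theory Num.Theory.
Import numFieldNormedType.Exports.

Set Implicit Arguments.
Unset Strict Implicit.
Unset Printing Implicit Defensive.

Local Open Scope classical_set_scope.
Local Open Scope ring_scope.

(** * Independence: product formula for integrals, and independence from the past *)

Section independence.
Context d (T : measurableType d) (R : realType) (P : probability T R).

Definition independent_rv d1 d2 (T1 : measurableType d1)
    (T2 : measurableType d2) (f : T -> T1) (g : T -> T2) :=
  forall A B, measurable A -> measurable B ->
    P ((f @^-1` A) `&` (g @^-1` B)) = (P (f @^-1` A) * P (g @^-1` B))%E.

Lemma independent_rv_comp d1 d2 d3 d4 (T1 : measurableType d1)
    (T2 : measurableType d2) (T3 : measurableType d3) (T4 : measurableType d4)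
    (f : T -> T1) (g : T -> T2) (h : T1 -> T3) (k : T2 -> T4) :
  measurable_fun setT h -> measurable_fun setT k ->
  independent_rv f g -> independent_rv (h \o f) (k \o g).
Proof.
move=> mh mk fg A B mA mB; apply: (fg (h @^-1` A) (k @^-1` B)).
  by rewrite -[X in measurable X]setTI; exact: mh.
by rewrite -[X in measurable X]setTI; exact: mk.
Qed.

(** Independence makes the law of [(f, g)] the product of the two laws. Tonelli then gives the
    integrability of the product, and Fubini the factorisation of its integral. *)
Lemma independent_rv_integrableM (f g : T -> R) :
  P.-integrable setT (EFin \o f) -> P.-integrable setT (EFin \o g) ->
  independent_rv f g ->
  P.-integrable setT (EFin \o (fun w => f w * g w)) /\
  (\int[P]_w (f w * g w) = (\int[P]_w f w) * (\int[P]_w g w))%R.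
Proof.
move=> fi gi fg.
have mf : measurable_fun setT f.
  by move/integrableP : fi => -[/measurable_EFinP].
have mg : measurable_fun setT g.
  by move/integrableP : gi => -[/measurable_EFinP].
have mfg : measurable_fun setT (fun w => (f w, g w)).
  exact: measurable_fun_pair.
pose X : {mfun T >-> R} := mfun_Sub (mem_set mf).
pose Y : {mfun T >-> R} := mfun_Sub (mem_set mg).
pose XY : {mfun T >-> (R * R)%type} := mfun_Sub (mem_set mfg).
have XYE (C : set (R * R)) : measurable C ->
    (distribution P X \x distribution P Y)%E C = distribution P XY C.
  by move=> mC; apply: product_measure_unique => // A B mA mB; exact: fg.
pose m z : \bar R := (z.1 * z.2 : R)%:E.
have mm : measurable_fun setT (m : R * R -> _).
  by apply/measurable_EFinP; apply: measurable_funM.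
have fm : P.-integrable setT (EFin \o (fun w => f w * g w)).
  apply/integrableP; split.
    by apply/measurable_EFinP; exact: measurable_funM.
  have -> : (\int[P]_x `|(EFin \o (fun w => (f w * g w)%R)) x|)%E =
     (\int[P]_w ((abse \o m) \o XY) w)%E by [].
  have mam : measurable_fun setT (abse \o m) by exact: measurableT_comp.
  have am0 y : (0 <= (abse \o m) y)%E by exact: abse_ge0.
  rewrite -(ge0_integral_distribution (XY : {RV P >-> _}) mam am0).
  rewrite (eq_measure_integral (distribution P X \x distribution P Y)%E);
    last first.
    by move=> C mC _; exact/esym/XYE.
  rewrite (fubini_tonelli1 _ mam am0) /fubini_F.
  have : (\int[distribution P X]_x `|x%:E| < +oo)%E.
    rewrite (ge0_integral_distribution (X : {RV P >-> R})) //=.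
      by move/integrableP : fi => [].
    by apply: measurableT_comp.
  have : (\int[distribution P Y]_x `|x%:E| < +oo)%E.
    rewrite (ge0_integral_distribution (Y : {RV P >-> R})) //=.
      by move/integrableP : gi => [].
    by apply: measurableT_comp.
  set c := (\int[_]_x _)%E => c1 c2.
  have mE (x : R) :
      (\int[distribution P Y]_y (abse \o m) (x, y) = `|x%:E| * c)%E.
    rewrite /c -ge0_integralZl//; last exact: measurableT_comp.
    by apply: eq_integral => y _; rewrite /m /= normrM EFinM.
  under eq_integral do rewrite mE.
  rewrite ge0_integralZr//.
  - have cfin : c \is a fin_num by rewrite ge0_fin_numE// integral_ge0.
    have c2fin : (\int[distribution P X]_x `|x%:E|)%E \is a fin_num.
      by rewrite ge0_fin_numE// integral_ge0.
    by rewrite -(fineK cfin) -(fineK c2fin) -EFinM ltry.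
  - by apply: measurableT_comp.
  - exact: integral_ge0.
split => //.
rewrite /Rintegral.
have -> : (\int[P]_x (f x * g x)%:E = \int[P]_w (m \o XY) w)%E by [].
have XYi : (distribution P XY).-integrable setT m.
  by apply: integrable_pushforward.
rewrite -integral_distribution//.
rewrite (eq_measure_integral (distribution P X \x distribution P Y)%E);
  last first.
  by move=> C mC _; exact/esym/XYE.
have ii : ((distribution P X) \x (distribution P Y))%E.-integrable setT m.
  apply/integrableP; split => //.
  move/integrableP : XYi => [_].
  rewrite (eq_measure_integral (distribution P X \x distribution P Y)%E)//.
  by move=> C mC _; exact/esym/XYE.
rewrite -integral12_prod_meas1//= /fubini_F/m/=.
have Xi : (distribution P X).-integrable setT (@EFin R).
  by apply: integrable_pushforward => //; exact: EFin_measurable.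
have Yi : (distribution P Y).-integrable setT (@EFin R).
  by apply: integrable_pushforward => //; exact: EFin_measurable.
have cfin := integrable_fin_num measurableT Yi.
under eq_integral => x _.
  under eq_integral do rewrite EFinM.
  rewrite integralZl//.
  rewrite -(fineK cfin).
  over.
rewrite integralZr// fineM//; last exact: integrable_fin_num.
have mE : measurable_fun setT (@EFin R) by exact: EFin_measurable.
rewrite (@integral_distribution _ _ _ _ _ P Y _ mE gi).
by rewrite (@integral_distribution _ _ _ _ _ P X _ mE fi).
Qed.

Definition past d' (U : measurableType d') (Z : nat -> T -> U) (i : nat) :
    set (set T) :=
  \bigcup_(j in [set j | (j < i)%N]) preimage_set_system setT (Z j) measurable.

(** A pi-lambda argument. The cylinders [G] are stable under intersection and their sigma-algebra
    contains the past; mutual independence gives the product formula on them, and the events [H]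
    that satisfy it form a Dynkin system. *)
Lemma past_independent d' (U : measurableType d') (Z : nat -> {RV P >-> U}) i :
  mutually_independent Z -> forall A B, <<s past Z i >> A -> measurable B ->
  P (A `&` Z i @^-1` B) = (P A * P (Z i @^-1` B))%E.
Proof.
move=> Zind A B pA mB.
pose J : {fset nat} := [fset j | j in iota 0 i]%fset.
have JE j : (j \in J) = (j < i)%N by rewrite !inE/= mem_iota.
pose G : set (set T) := [set \bigcap_(j in [set` J]) (Z j @^-1` C j) |
  C in [set C : nat -> set U | forall j, measurable (C j)]].
have GI : setI_closed G.
  move=> _ _ [C mC <-] [D mD <-]; exists (fun j => C j `&` D j).
    by move=> j; exact: measurableI.
  by rewrite -bigcapI; apply: eq_bigcapr => j _; rewrite preimage_setI.
have mZ j (C : set U) : measurable C -> measurable (Z j @^-1` C).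
  by move=> mC; rewrite -[X in measurable X]setTI; exact: measurable_funP.
pose H : set (set T) := [set A | measurable A /\
  P (A `&` Z i @^-1` B) = (P A * P (Z i @^-1` B))%E].
have GH : G `<=` H.
  move=> _ [C mC <-]; split.
    by apply: bigcap_measurableType => j _; exact: mZ.
  pose D j := if j == i then B else C j.
  have iJ : i \notin J by rewrite JE ltnn.
  have mD j : measurable (D j) by rewrite /D; case: ifP.
  have DC j : j \in J -> D j = C j.
    by rewrite JE /D; case: eqVneq => // ->; rewrite ltnn.
  have := Zind (i |` J)%fset D (fun j _ => mD j).
  have -> : [set` (i |` J)%fset] = [set i] `|` [set` J].
    apply/seteqP; split => j /=; rewrite !inE.
      by move=> /orP[/eqP|]; [left|right].
    by move=> [->|jJ]; [rewrite eqxx|rewrite jJ orbT].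
  rewrite bigcap_setU bigcap_set1 {1}/D eqxx setIC => DE.
  have CE : \bigcap_(j in [set` J]) (Z j @^-1` D j) =
            \bigcap_(j in [set` J]) (Z j @^-1` C j).
    by apply: eq_bigcapr => j /DC ->.
  rewrite -CE DE big_fsetU1//= muleC {2}/D eqxx; congr (_ * _)%E.
  by rewrite Zind.
suff: <<s past Z i >> `<=` H by move=> /(_ _ pA)[].
apply: (@subset_trans _ <<s G >>).
  apply: smallest_sub; first exact: smallest_sigma_algebra.
  move=> _ [j /= ji [C mC <-]]; apply: sub_sigma_algebra.
  (* An event about a single [Z j] is a cylinder whose other coordinates are unconstrained. *)
  exists (fun k => if k == j then C else setT).
    by move=> k; case: ifP.
  rewrite setTI; apply/seteqP; split => [w /(_ j)/=|w /= Cw k _/=].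
    by rewrite eqxx; apply; rewrite JE.
  by case: eqVneq => // ->.
have PE : P (Z i @^-1` B) \is a fin_num by apply: fin_num_measure; exact: mZ.
apply: lambda_system_subset => //; apply/dynkin_lambda_system; split.
- by split => //; rewrite setTI probability_setT mul1e.
- move=> C [mC CE]; split; first exact: measurableC.
  rewrite probability_setC// muleBl// mul1e -CE.
  rewrite setIC -setDE measureD; [|exact: mZ|by []|by rewrite ltey_eq PE].
  by rewrite setIC.
- move=> F tF HF; have mF n : measurable (F n) by have [] := HF n.
  split; first exact: bigcup_measurable.
  rewrite setI_bigcupl !measure_bigcup//.
  + rewrite muleC -(fineK PE) -nneseriesZl//; apply: eq_eseriesr => n _.
    by have [_ /= ->] := HF n; rewrite fineK// muleC.
  + by move=> n _; apply: measurableI => //; exact: mZ.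
  + exact: trivIset_setIr.
Qed.

End independence.

(** * Pathwise inequalities for the overshoot of partial sums *)

Section excess.
Variable R : realType.
Implicit Types (y : nat -> R) (l x z : R).

(** The overshoot above the level [l] of the running maximum of the partial sums of [y], cut off at
    0. The recursive form fits the one-step martingale arguments below. *)
Fixpoint excess l y n : R :=
  if n is m.+1 then Num.max (excess l y m) (\sum_(i < m.+1) y i - l) else 0.

Lemma excess_ge0 l y n : 0 <= excess l y n.
Proof. by elim: n => //= n IHn; rewrite le_max IHn. Qed.

Lemma sum_le_excess l y n i : 0 <= l -> (i <= n)%N ->
  \sum_(j < i) y j <= excess l y n + l.
Proof.
move=> l0; elim: n => [|n IHn].
  by rewrite leqn0 => /eqP ->; rewrite big_ord0 add0r.
rewrite leq_eqVlt ltnS => /predU1P[->|/IHn]/=.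
  by rewrite -lerBlDr le_max lexx orbT.
by move=> /le_trans; apply; rewrite lerD2r le_max lexx.
Qed.

(* The increment of [2 N V - N^2] dominates the martingale increment [2 N y],
   with equality unless the maximum moves. *)
Lemma excess_step l y n (N := excess l y)
    (V := fun k => \sum_(i < k) y i - l) :
  2 * (N n * V n) - N n ^+ 2 + 2 * (N n * y n) <=
  2 * (N n.+1 * V n.+1) - N n.+1 ^+ 2.
Proof.
have VS : V n.+1 = V n + y n by rewrite /V big_ord_recr/=; lra.
have -> : N n.+1 = Num.max (N n) (V n.+1) by [].
rewrite VS.
have [h|h] := leP (N n) (V n + y n); last by lra.
have := sqr_ge0 (V n + y n - N n); nra.
Qed.

Lemma ler_sqr_pospart x z : x <= z -> Num.max 0 x ^+ 2 <= Num.max 0 z ^+ 2.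
Proof.
by move=> xz; have [h|h] := leP 0 x; have [k|k] := leP 0 z; nra.
Qed.

(** The left side is at most $((x-l)_+ + z)^2$, and the right side is the expansion of this
    square. *)
Lemma sqr_pospart_step l x z :
  Num.max 0 (x + z - l) ^+ 2 <=
  Num.max 0 (x - l) ^+ 2 + 2 * (Num.max 0 (x - l) * z) + z ^+ 2.
Proof.
have [h|h] := leP 0 (x + z - l); have [k|k] := leP 0 (x - l); try nra.
Qed.

(* The quadratic term only matters if [x > l / 2] or [`|z| > l / 2]; the two
   indicators are replaced by continuous majorants. *)
Lemma sqr_pospart_step_tail l x z : 0 < l ->
  Num.max 0 (x + z - l) ^+ 2 <=
  Num.max 0 (x - l) ^+ 2 + 2 * (Num.max 0 (x - l) * z)
  + (4 / l ^+ 2 * (Num.max 0 x ^+ 2 * z ^+ 2)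
     + 4 * Num.max 0 (`|z| - l / 4) ^+ 2).
Proof.
move=> l0.
have c0 : 0 <= 4 / l ^+ 2 * (Num.max 0 x ^+ 2 * z ^+ 2).
  by apply: mulr_ge0; [apply: divr_ge0|apply: mulr_ge0] => //; exact: sqr_ge0.
have [zl|lz] := leP (`|z|) (l / 2); last first.
  apply: (le_trans (sqr_pospart_step l x z)); rewrite lerD2l.
  have -> : Num.max 0 (`|z| - l / 4) = `|z| - l / 4 by apply/max_r; lra.
  rewrite -[leLHS]add0r; apply: lerD.
    exact: c0.
  by rewrite -(real_normK (num_real z)); nra.
have h4 : 0 <= 4 * Num.max 0 (`|z| - l / 4) ^+ 2 by rewrite mulr_ge0// sqr_ge0.
have [xl|lx] := leP x (l / 2).
  have zl' : z <= l / 2 by exact: le_trans (ler_norm _) zl.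
  rewrite (max_l (_ : x + z - l <= 0)) ?expr0n/=; last by lra.
  rewrite (max_l (_ : x - l <= 0)) ?expr0n/=; last by lra.
  by rewrite mul0r mulr0 !add0r addr_ge0.
apply: (le_trans (sqr_pospart_step l x z)); rewrite lerD2l -[leLHS]addr0.
apply: lerD => //.
rewrite mulrA -[leLHS]mul1r ler_wpM2r ?sqr_ge0//.
rewrite (max_r (_ : 0 <= x)); last by lra.
rewrite mulrAC ler_pdivlMr ?exprn_gt0// mul1r; nra.
Qed.

End excess.

(** * Closure properties of square-integrable functions *)

Section square_integrable.
Context d (T : measurableType d) (R : realType) (P : probability T R).
Implicit Types f g : T -> R.

Lemma Rintegrable_add f g : P.-integrable setT (EFin \o f) ->
  P.-integrable setT (EFin \o g) ->
  P.-integrable setT (EFin \o (fun w => f w + g w)).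
Proof. by move=> fi gi; exact: (integrableD measurableT fi gi). Qed.

Lemma Rintegrable_sub f g : P.-integrable setT (EFin \o f) ->
  P.-integrable setT (EFin \o g) ->
  P.-integrable setT (EFin \o (fun w => f w - g w)).
Proof. by move=> fi gi; exact: (integrableB measurableT fi gi). Qed.

Lemma Rintegrable_scale c f : P.-integrable setT (EFin \o f) ->
  P.-integrable setT (EFin \o (fun w => c * f w)).
Proof. by move=> fi; exact: (integrableZl measurableT c fi). Qed.

Lemma Rintegral_prob_cst c : \int[P]_w c = c :> R.
Proof.
rewrite Rintegral_cst// [X in fine X](_ : _ = 1%E) ?mulr1//.
exact: probability_setT.
Qed.

Lemma Lfun2_measurable f : f \in Lfun P 2%:E -> measurable_fun setT f.
Proof. by rewrite inE => /andP[/[!inE]]. Qed.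

Lemma Lfun2_sqr f : f \in Lfun P 2%:E ->
  P.-integrable setT (EFin \o (fun w => f w ^+ 2)).
Proof. exact: Lfun2_integrable_sqr. Qed.

Lemma Lnorm2E f :
  ('N[P]_2%:E[EFin \o f] = (\int[P]_w (f w ^+ 2)%:E) `^ 2^-1)%E.
Proof.
rewrite unlock; congr (_ `^ _)%E; apply: eq_integral => w _ /=.
by rewrite powR_mulrn// real_normK// num_real.
Qed.

Lemma sqr_Lfun2 f : measurable_fun setT f ->
  P.-integrable setT (EFin \o (fun w => f w ^+ 2)) -> f \in Lfun P 2%:E.
Proof.
move=> mf fi; rewrite inE; apply/andP; split; rewrite inE//=.
rewrite /finite_norm Lnorm2E poweR_lty//.
exact: integrable_lty.
Qed.

Lemma le_Lfun2 f g : measurable_fun setT f -> (forall w, `|f w| <= `|g w|) ->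
  g \in Lfun P 2%:E -> f \in Lfun P 2%:E.
Proof.
move=> mf fg g2; apply: sqr_Lfun2 => //.
apply: (le_integrable measurableT _ _ (Lfun2_sqr g2)).
  by apply/measurable_EFinP; exact: measurable_funX.
by move=> w _ /=; rewrite lee_fin !normrX lerXn2r ?nnegrE.
Qed.

Lemma Lfun2_integrableM f g : f \in Lfun P 2%:E -> g \in Lfun P 2%:E ->
  P.-integrable setT (EFin \o (fun w => f w * g w)).
Proof. by move=> f2 g2; apply/Lfun1_integrable; exact: Lfun2_mul_Lfun1. Qed.

Lemma Lfun2D f g : f \in Lfun P 2%:E -> g \in Lfun P 2%:E ->
  (fun w => f w + g w) \in Lfun P 2%:E.
Proof. by move=> f2 g2; rewrite -[X in X \in _]/(f + g) rpredD// lee1n. Qed.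

Lemma Lfun2N f : f \in Lfun P 2%:E -> (fun w => - f w) \in Lfun P 2%:E.
Proof. by move=> f2; rewrite -[X in X \in _]/(- f) rpredN// lee1n. Qed.

Lemma Lfun2B f g : f \in Lfun P 2%:E -> g \in Lfun P 2%:E ->
  (fun w => f w - g w) \in Lfun P 2%:E.
Proof. by move=> f2 g2; apply: Lfun2D => //; exact: Lfun2N. Qed.

Lemma Lfun2_cst c : (fun=> c) \in Lfun P 2%:E.
Proof. exact: Lfun_cst. Qed.

Lemma Lfun2_integrable f : f \in Lfun P 2%:E -> P.-integrable setT (EFin \o f).
Proof.
move=> f2; have := Lfun2_integrableM f2 (Lfun2_cst 1).
by apply: eq_integrable => // w _ /=; rewrite mulr1.
Qed.

Lemma Lfun2_max f g : f \in Lfun P 2%:E -> g \in Lfun P 2%:E ->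
  (fun w => Num.max (f w) (g w)) \in Lfun P 2%:E.
Proof.
move=> f2 g2.
have n2 h : h \in Lfun P 2%:E -> (fun w => `|h w|) \in Lfun P 2%:E.
  move=> h2; apply: (le_Lfun2 _ _ h2); last by move=> w; rewrite normr_id.
  by apply: measurableT_comp => //; exact: (Lfun2_measurable h2).
apply: le_Lfun2 (Lfun2D (n2 _ f2) (n2 _ g2)).
  by apply: measurable_maxr; [exact: Lfun2_measurable f2|
    exact: Lfun2_measurable g2].
move=> w; rewrite [leRHS]ger0_norm ?addr_ge0//.
by have [_|_] := leP (f w) (g w); rewrite ?lerDl ?lerDr ?normr_ge0.
Qed.

Lemma Lfun2_sum (I : Type) (s : seq I) (F : I -> T -> R) :
  (forall i, F i \in Lfun P 2%:E) ->
  (fun w => \sum_(i <- s) F i w) \in Lfun P 2%:E.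
Proof.
move=> F2; elim: s => [|i s IHs].
  by under eq_fun do rewrite big_nil; exact: Lfun2_cst.
by under eq_fun do rewrite big_cons; exact: Lfun2D.
Qed.

End square_integrable.

(** * Functions of the past of a sequence *)

Section adapted.
Context d (T : measurableType d) (R : realType) (P : probability T R).
Context d' (U : measurableType d') (Z : nat -> {RV P >-> U}).

(** The past at time [k] stops at [Z (k - 1)], so that such an [f] is independent of [Z k] and can
    multiply a centered function of [Z k] in a martingale increment. *)
Definition adapted k (f : T -> R) :=
  @measurable_fun _ _ (g_sigma_algebraType (past (fun i => Z i) k)) R setT f.

Lemma adaptedW k m f : (k <= m)%N -> adapted k f -> adapted m f.
Proof.
move=> km mf mT B mB; have := mf measurableT B mB.
apply: sub_sigma_algebra2 => _ [j /= jk [C mC <-]].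
by exists j; [exact: leq_trans km|exists C].
Qed.

Lemma adapted_comp k j (h : U -> R) : (j < k)%N -> measurable_fun setT h ->
  adapted k (h \o Z j).
Proof.
move=> jk mh mT B mB; apply: sub_sigma_algebra; exists j => //.
by exists (h @^-1` B); rewrite ?setTI// -[X in measurable X]setTI; exact: mh.
Qed.

Hypothesis Zind : mutually_independent Z.

Lemma adapted_independent k f : adapted k f -> independent_rv P f (Z k).
Proof.
move=> mf A B mA mB; apply: past_independent => //.
by rewrite -[X in _ X]setTI; exact: mf.
Qed.

End adapted.

(** * Doob's inequality for the overshoot of a centered random walk *)

Section maximal.
Context d (T : measurableType d) (R : realType) (P : probability T R).
Context d' (U : measurableType d') (Z : nat -> {RV P >-> U}) (h : U -> R).
Hypothesis Zind : mutually_independent Z.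
Hypothesis mh : measurable_fun setT h.
Hypothesis h2 : forall i, h \o Z i \in Lfun P 2%:E.
Hypothesis h0 : forall i, \int[P]_w h (Z i w) = 0.
Variable a : nat.

(** The sums start at an arbitrary time [a], because the fluctuations over the last steps of a walk
    have to be bounded as well as those over the first ones. *)
Let Y i w := h (Z (a + i)%N w).
Let V n w := \sum_(i < n) Y i w.
Let N l n w := excess l (Y ^~ w) n.

Let V0 : V 0%N = fun=> 0.
Proof. by apply/funext => w; rewrite /V big_ord0. Qed.

Let VS n : V n.+1 = fun w => V n w + Y n w.
Proof. by apply/funext => w; rewrite /V big_ord_recr. Qed.

Let adaptedV n : adapted Z (a + n) (V n).
Proof.
elim: n => [|n IHn]; first by rewrite V0; exact: measurable_cst.
rewrite VS; apply: measurable_funD.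
  by apply: (adaptedW _ IHn); rewrite addnS.
by apply: adapted_comp => //; rewrite addnS.
Qed.

Let adaptedN l n : adapted Z (a + n) (N l n).
Proof.
rewrite /adapted /N; elim: n => [|n IHn] /=; first exact: measurable_cst.
apply: measurable_maxr.
  by apply: (adaptedW _ IHn); rewrite addnS.
by apply: measurable_funB; [exact: adaptedV|exact: measurable_cst].
Qed.

Let V2 n : V n \in Lfun P 2%:E.
Proof. by rewrite /V; apply: Lfun2_sum => i; exact: h2. Qed.

Let N2 l n : N l n \in Lfun P 2%:E.
Proof.
rewrite /N; elim: n => [|n IHn] /=; first exact: Lfun2_cst.
by apply: Lfun2_max => //; apply: Lfun2B; [exact: V2|exact: Lfun2_cst].
Qed.

(** Orthogonality of martingale increments: [f] is independent of the new step, which is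
    centered. *)
Let fY_eq0 n f : adapted Z (a + n) f -> f \in Lfun P 2%:E ->
  \int[P]_w (f w * Y n w) = 0.
Proof.
move=> af f2.
have [_ ->] := @independent_rv_integrableM _ _ _ P f (Y n)
  (Lfun2_integrable f2) (Lfun2_integrable (h2 _))
  (independent_rv_comp (@measurable_id _ R setT) mh
    (adapted_independent Zind af)).
by rewrite [X in _ * X]h0 mulr0.
Qed.

(** Only second moments are available; the product of the two squares is integrable thanks to the
    independence of [f] and the new step. *)
Let fY2 n f : adapted Z (a + n) f -> f \in Lfun P 2%:E ->
  P.-integrable setT (EFin \o (fun w => f w ^+ 2 * Y n w ^+ 2)) /\
  \int[P]_w (f w ^+ 2 * Y n w ^+ 2) =
    (\int[P]_w (f w ^+ 2)) * (\int[P]_w (Y n w ^+ 2)).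
Proof.
move=> af f2.
have mX : measurable_fun setT (fun x : R => x ^+ 2) by exact: measurable_funX.
exact: (@independent_rv_integrableM _ _ _ P _ _
  (Lfun2_sqr f2) (Lfun2_sqr (h2 _))
  (independent_rv_comp mX (measurableT_comp mX mh)
    (adapted_independent Zind af))).
Qed.

Let pV l n : (fun w => Num.max 0 (V n w - l)) \in Lfun P 2%:E.
Proof.
by apply: Lfun2_max; [|apply: Lfun2B => //]; exact: Lfun2_cst.
Qed.

Let apV l n : adapted Z (a + n) (fun w => Num.max 0 (V n w - l)).
Proof.
apply: measurable_maxr; first exact: measurable_cst.
by apply: measurable_funB; [exact: adaptedV|exact: measurable_cst].
Qed.

Let Psi l n w := 2 * (N l n w * (V n w - l)) - N l n w ^+ 2.

Let Psi_int l n : P.-integrable setT (EFin \o Psi l n).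
Proof.
have VlL : (fun w => V n w - l) \in Lfun P 2%:E.
  by apply: Lfun2B => //; exact: Lfun2_cst.
apply: Rintegrable_sub; last exact: Lfun2_sqr.
by apply: Rintegrable_scale; exact: Lfun2_integrableM.
Qed.

Let fYZ_int n f (c : R) : f \in Lfun P 2%:E ->
  P.-integrable setT (EFin \o (fun w => c * (f w * Y n w))).
Proof.
move=> f2.
exact: (Rintegrable_scale c (Lfun2_integrableM f2 (h2 (a + n)%N))).
Qed.

(** In [excess_step] the martingale increment [2 N Y] has mean zero, so the mean of [Psi] never
    decreases from its initial value 0. *)
Let Psi_ge0 l n : 0 <= \int[P]_w Psi l n w.
Proof.
elim: n => [|n IHn].
  rewrite (@eq_Rintegral _ _ _ _ _ (fun=> 0)).
    by rewrite Rintegral_cst// mul0r.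
  by move=> w _; rewrite /Psi /N/= mul0r mulr0 expr0n subr0.
apply: (le_trans IHn).
rewrite -[leLHS]addr0 -[X in _ + X](mulr0 2) -(fY_eq0 (@adaptedN l n) (N2 l n)).
rewrite -RintegralZl//; last exact: (Lfun2_integrableM (N2 l n) (h2 _)).
have i1 := Psi_int l n; have i2 := fYZ_int n 2 (N2 l n).
rewrite -RintegralD//.
apply: le_Rintegral => //.
- exact: Rintegrable_add i1 i2.
- by move=> w _; exact: (excess_step l (Y ^~ w) n).
Qed.

(* Doob's L^2 inequality for the overshoot: bound the integrand [Psi] from above
   by [2 (V - l)_+^2 - N^2 / 2]. *)
Let doob l n : \int[P]_w (N l n w ^+ 2) <=
  4 * \int[P]_w (Num.max 0 (V n w - l) ^+ 2).
Proof.
have pVi := Lfun2_sqr (pV l n); have Ni := Lfun2_sqr (N2 l n).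
have pVi2 : P.-integrable setT
    (EFin \o (fun w => 2 * Num.max 0 (V n w - l) ^+ 2)).
  exact: (Rintegrable_scale 2 pVi).
have Ni2 : P.-integrable setT (EFin \o (fun w => 2^-1 * N l n w ^+ 2)).
  exact: (Rintegrable_scale 2^-1 Ni).
have : 0 <= \int[P]_w (2 * Num.max 0 (V n w - l) ^+ 2 - 2^-1 * N l n w ^+ 2).
  apply: (le_trans (Psi_ge0 l n)); apply: le_Rintegral => //.
  - exact: (Rintegrable_sub pVi2 Ni2).
  - move=> w _; rewrite /Psi.
    have := excess_ge0 l (Y ^~ w) n; rewrite -/(N l n w) => N0.
    have [h1|h1] := leP 0 (V n w - l).
      by have := sqr_ge0 (2 * (V n w - l) - N l n w); nra.
    by nra.
by rewrite RintegralB// !RintegralZl//; lra.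
Qed.

Variables (s t l : R).
Hypothesis l_gt0 : 0 < l.
Hypothesis Ys : forall i, \int[P]_w (h (Z i w) ^+ 2) <= s.
Hypothesis Yt : forall i,
  \int[P]_w (4 * Num.max 0 (`|h (Z i w)| - l / 4) ^+ 2) <= t.

(** The cross term of the one-step expansion has mean zero, so each step adds at most [s]. *)
Let pV_sqr n : \int[P]_w (Num.max 0 (V n w - 0) ^+ 2) <= n%:R * s.
Proof.
elim: n => [|n IHn].
  rewrite (@eq_Rintegral _ _ _ _ _ (fun=> 0)).
    by rewrite Rintegral_cst// !mul0r.
  by move=> w _; rewrite V0 subr0 maxxx expr0n.
have i1 := Lfun2_sqr (pV 0 n); have i2 := fYZ_int n 2 (pV 0 n).
have i3 := Lfun2_sqr (h2 (a + n)%N).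
have i12 := Rintegrable_add i1 i2.
apply: (@le_trans _ _ (\int[P]_w (Num.max 0 (V n w - 0) ^+ 2 +
   2 * (Num.max 0 (V n w - 0) * Y n w) + Y n w ^+ 2))).
  apply: le_Rintegral => //; first exact: (Lfun2_sqr (pV 0 n.+1)).
    exact: (Rintegrable_add i12 i3).
  by move=> w _; rewrite VS; exact: sqr_pospart_step.
rewrite RintegralD// RintegralD// RintegralZl//; last first.
  exact: (Lfun2_integrableM (pV 0 n) (h2 _)).
rewrite (fY_eq0 (@apV 0 n) (pV 0 n)) mulr0 addr0 -natr1 mulrDl mul1r.
by apply: lerD => //; exact: Ys.
Qed.

(** Each step costs at most $(4/l^2)\,E V_+^2\,E Y^2 + t$, where $E V_+^2 \le n s$ by the previous
    bound. For [l] of order [n] the first terms add up to a constant, and the others to [n t], with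
    [t] governed by the tail of a single step. *)
Let pV_sqr_tail n : \int[P]_w (Num.max 0 (V n w - l) ^+ 2) <=
  n%:R * (4 * n%:R * (s / l) ^+ 2 + t).
Proof.
have s0 : 0 <= s.
  by apply: le_trans (Ys 0); apply: Rintegral_ge0 => w _; exact: sqr_ge0.
(* The cost per step is frozen at its value for [n] while [m] runs, so that the induction adds the
   same amount each time. *)
have main m : (m <= n)%N -> \int[P]_w (Num.max 0 (V m w - l) ^+ 2) <=
    m%:R * (4 * n%:R * (s / l) ^+ 2 + t).
  elim: m => [_|m IHm mn].
    rewrite (@eq_Rintegral _ _ _ _ _ (fun=> 0)).
      by rewrite Rintegral_cst// !mul0r.
    by move=> w _; rewrite V0 sub0r max_l ?expr0n// oppr_le0 ltW.
  have i1 := Lfun2_sqr (pV l m); have i2 := fYZ_int m 2 (pV l m).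
  have apV0 : adapted Z (a + m) (fun w => Num.max 0 (V m w)).
    by under eq_fun do rewrite -[V m _]subr0; exact: apV.
  have pV0 : (fun w => Num.max 0 (V m w)) \in Lfun P 2%:E.
    by under eq_fun do rewrite -[V m _]subr0; exact: pV.
  have [i3 e3] := fY2 apV0 pV0.
  have i3' := Rintegrable_scale (4 / l ^+ 2) i3.
  have i4 : P.-integrable setT (EFin \o (fun w =>
      Num.max 0 (`|Y m w| - l / 4) ^+ 2)).
    apply: Lfun2_sqr; apply: Lfun2_max; first exact: Lfun2_cst.
    apply: Lfun2B; last exact: Lfun2_cst.
    by apply: (le_Lfun2 _ _ (h2 (a + m)%N)) => [|w];
      [apply: measurableT_comp => //; exact: (Lfun2_measurable (h2 _))|
       rewrite normr_id].
  have i4' := Rintegrable_scale 4 i4.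
  have i12 := Rintegrable_add i1 i2.
  have i34 := Rintegrable_add i3' i4'.
  apply: (@le_trans _ _ (\int[P]_w (Num.max 0 (V m w - l) ^+ 2 +
     2 * (Num.max 0 (V m w - l) * Y m w) +
     (4 / l ^+ 2 * (Num.max 0 (V m w) ^+ 2 * Y m w ^+ 2) +
      4 * Num.max 0 (`|Y m w| - l / 4) ^+ 2)))).
    apply: le_Rintegral => //; first exact: (Lfun2_sqr (pV l m.+1)).
      exact: (Rintegrable_add i12 i34).
    by move=> w _; rewrite VS; exact: sqr_pospart_step_tail.
  rewrite RintegralD// RintegralD// [X in _ + X]RintegralD//.
  rewrite (RintegralZl _ _ i3)// (RintegralZl 2)//; last first.
    exact: (Lfun2_integrableM (pV l m) (h2 _)).
  rewrite (fY_eq0 (@apV l m) (pV l m)) mulr0 addr0.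
  have mS (x : R) : m.+1%:R * x = m%:R * x + x by rewrite -natr1 mulrDl mul1r.
  rewrite mS e3; apply: lerD; first exact/IHm/ltnW.
  apply: lerD; last exact: Yt.
  have := pV_sqr m; under eq_Rintegral do rewrite subr0.
  set c := \int[P]_w _ => cm.
  have Y0 : 0 <= \int[P]_w (Y m w ^+ 2).
    by apply: Rintegral_ge0 => w _; exact: sqr_ge0.
  have c0 : 0 <= c by apply: Rintegral_ge0 => w _; exact: sqr_ge0.
  apply: (@le_trans _ _ (4 / l ^+ 2 * (n%:R * s * s))).
    apply: ler_wpM2l; first by apply: divr_ge0 => //; exact: sqr_ge0.
    apply: ler_pM => //; last exact: Ys.
    by apply: (le_trans cm); rewrite ler_wpM2r// ler_nat ltnW.
  by rewrite le_eqVlt; apply/orP; left; apply/eqP; field; rewrite gt_eqF.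
exact: main.
Qed.

Lemma excess0_sqr n :
  \int[P]_w (excess 0 (fun i => h (Z (a + i)%N w)) n ^+ 2) <= 4 * (n%:R * s).
Proof. by apply: (le_trans (doob 0 n)); rewrite ler_pM2l. Qed.

Lemma excess_sqr n :
  \int[P]_w (excess l (fun i => h (Z (a + i)%N w)) n ^+ 2) <=
  4 * (n%:R * (4 * n%:R * (s / l) ^+ 2 + t)).
Proof. by apply: (le_trans (doob l n)); rewrite ler_pM2l. Qed.

Lemma excess_Lfun2 c n :
  (fun w => excess c (fun i => h (Z (a + i)%N w)) n) \in Lfun P 2%:E.
Proof. exact: N2. Qed.

End maximal.

(** * Euclidean geometry of the plane *)

Section plane.
Variable R : realType.
Implicit Types (u v : R * R) (c : R).

Lemma enorm_ge0 u : 0 <= enorm u. Proof. exact: sqrtr_ge0. Qed.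

Lemma dot_ge0 u : 0 <= dot u u.
Proof. by rewrite /dot -!expr2 addr_ge0// sqr_ge0. Qed.

Lemma enorm_sqr u : enorm u ^+ 2 = dot u u.
Proof. by rewrite sqr_sqrtr// dot_ge0. Qed.

Lemma enorm_le u c : 0 <= c -> (enorm u <= c) = (dot u u <= c ^+ 2).
Proof. by move=> c0; rewrite -enorm_sqr ler_sqr ?nnegrE ?enorm_ge0. Qed.

Lemma ler_dot u v : `|dot u v| <= enorm u * enorm v.
Proof.
have h0 : 0 <= enorm u * enorm v by rewrite mulr_ge0 ?enorm_ge0.
rewrite -ler_sqr ?nnegrE ?normr_ge0 ?h0// exprMn !enorm_sqr.
rewrite real_normK ?num_real//.
(* Lagrange's identity: the defect in the Cauchy-Schwarz inequality is the square of the
   determinant. *)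
by rewrite /dot; have := sqr_ge0 (u.1 * v.2 - u.2 * v.1); nra.
Qed.

Lemma enormD u v : enorm (u + v) <= enorm u + enorm v.
Proof.
rewrite enorm_le ?addr_ge0 ?enorm_ge0// sqrrD !enorm_sqr.
have := le_trans (ler_norm _) (ler_dot u v).
by rewrite /dot /=; lra.
Qed.

Lemma enormZ c u : enorm (c *: u) = `|c| * enorm u.
Proof.
rewrite /enorm (_ : dot _ _ = c ^+ 2 * dot u u).
  by rewrite sqrtrM ?sqr_ge0// sqrtr_sqr.
by rewrite /dot /= /GRing.scale/=; ring.
Qed.

Lemma enormN u : enorm (- u) = enorm u.
Proof. by rewrite -scaleN1r enormZ normrN1 mul1r. Qed.

Lemma enorm0 : enorm (0 : R * R) = 0.
Proof. by rewrite /enorm /dot mulr0 addr0 sqrtr0. Qed.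

Lemma enormB u v : enorm (u - v) <= enorm u + enorm v.
Proof. by rewrite -(enormN v) enormD. Qed.

Lemma enorm_distC u v : enorm (u - v) = enorm (v - u).
Proof. by rewrite -enormN opprB. Qed.

Lemma enorm_le_l1 u : enorm u <= `|u.1| + `|u.2|.
Proof.
rewrite enorm_le ?addr_ge0// /dot sqrrD !real_normK ?num_real// -!expr2.
by have := mulr_ge0 (normr_ge0 u.1) (normr_ge0 u.2); lra.
Qed.

Lemma dotBl u v w : dot (u - v) w = dot u w - dot v w.
Proof. by rewrite /dot/=; ring. Qed.

Lemma dotDl u v w : dot (u + v) w = dot u w + dot v w.
Proof. by rewrite /dot/=; ring. Qed.

Lemma dotZl c u w : dot (c *: u) w = c * dot u w.
Proof. by rewrite /dot/= /GRing.scale/=; ring. Qed.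

Lemma dot_suml (I : Type) (s : seq I) (F : I -> R * R) w :
  dot (\sum_(i <- s) F i) w = \sum_(i <- s) dot (F i) w.
Proof.
elim: s => [|i s IHs]; last by rewrite !big_cons dotDl IHs.
by rewrite !big_nil /dot !mul0r addr0.
Qed.

Lemma measurable_dot w : measurable_fun setT (fun u => dot u w).
Proof. by apply: measurable_funD; apply: measurable_funM. Qed.

Lemma measurable_enorm : measurable_fun setT (@enorm R).
Proof.
apply: measurableT_comp.
  exact: continuous_measurable_fun (@sqrt_continuous R).
by apply: measurable_funD; apply: measurable_funM.
Qed.

(** The maximal inequality is scalar and one-sided; norms are controlled through the projections on
    these four directions. *)
Definition axes : seq (R * R) := [:: (1, 0); (-1, 0); (0, 1); (0, -1)].

Lemma dot_axes_le u v : u \in axes -> `|dot v u| <= enorm v.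
Proof.
move=> uA; apply: (le_trans (ler_dot v u)).
rewrite -[leRHS]mulr1 ler_wpM2l ?enorm_ge0// enorm_le// /dot.
move: uA; rewrite !inE => /or4P[] /eqP -> /=; lra.
Qed.

Lemma enorm_le_axes v (F : R * R -> R) :
  (forall u, 0 <= F u) -> (forall u, u \in axes -> dot v u <= F u) ->
  enorm v <= \sum_(u <- axes) F u.
Proof.
move=> F0 vF; apply: (le_trans (enorm_le_l1 v)).
rewrite /axes !big_cons big_nil addr0 addrA; apply: lerD.
  have := vF (1, 0); have := vF (-1, 0); rewrite !inE !eqxx ?orbT /dot/=.
  move=> /(_ isT) h1 /(_ isT) h2; have := F0 (1, 0); have := F0 (-1, 0).
  by rewrite ler_norml; lra.
have := vF (0, 1); have := vF (0, -1); rewrite !inE !eqxx ?orbT /dot/=.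
move=> /(_ isT) h1 /(_ isT) h2; have := F0 (0, 1); have := F0 (0, -1).
by rewrite ler_norml; lra.
Qed.

End plane.

(** * Transfer of integrals between identically distributed variables *)

Section identical_laws.
Context d (T : measurableType d) (R : realType) (P : probability T R).
Context d' (U : measurableType d') (I : Type) (Z : I -> {RV P >-> U}).
Hypothesis Zid : identically_distributed Z.

Lemma identically_distributed_ge0_integral (f : U -> \bar R) i j :
  measurable_fun setT f -> (forall x, (0 <= f x)%E) ->
  (\int[P]_w f (Z i w) = \int[P]_w f (Z j w))%E.
Proof.
move=> mf f0.
rewrite -[LHS](ge0_integral_distribution (Z i) mf f0).
rewrite -[RHS](ge0_integral_distribution (Z j) mf f0).
by apply: eq_measure_integral => A mA _; exact: Zid.
Qed.

Lemma identically_distributed_Rintegral (f : U -> R) i j :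
  measurable_fun setT f -> \int[P]_w f (Z i w) = \int[P]_w f (Z j w).
Proof.
move=> mf; have mF : measurable_fun setT (EFin \o f) by exact/measurable_EFinP.
rewrite /Rintegral; congr fine.
rewrite [LHS](integralE P setT ((EFin \o f) \o Z i)).
rewrite [RHS](integralE P setT ((EFin \o f) \o Z j)).
rewrite (funepos_comp _ (Z i)) (funeneg_comp _ (Z i)).
rewrite (funepos_comp _ (Z j)) (funeneg_comp _ (Z j)); congr (_ - _)%E.
  exact: (identically_distributed_ge0_integral i j
    (measurable_funepos mF) (funepos_ge0 _)).
exact: (identically_distributed_ge0_integral i j
  (measurable_funeneg mF) (funeneg_ge0 _)).
Qed.

Lemma identically_distributed_Lfun2 (f : U -> R) i j :
  measurable_fun setT f -> f \o Z i \in Lfun P 2%:E ->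
  f \o Z j \in Lfun P 2%:E.
Proof.
move=> mf fi; apply: sqr_Lfun2; first exact: measurableT_comp.
have mf2 : measurable_fun setT (fun x => (f x ^+ 2)%:E).
  by apply/measurable_EFinP; exact: measurable_funX.
apply/integrableP; split.
  exact: (measurableT_comp mf2).
have /integrableP[_] := Lfun2_sqr fi; apply: le_lt_trans.
rewrite le_eqVlt; apply/orP; left; apply/eqP.
apply: (identically_distributed_ge0_integral
  (f := fun x => `|(f x ^+ 2)%:E|)%E) => //.
exact: measurableT_comp.
Qed.

End identical_laws.

(** * Second moments of the fluctuations of one walk *)

Section walk_bound.
Context d (T : measurableType d) (R : realType) (P : probability T R).
Variable Z : nat -> {RV P >-> (R * R)%type}.
Hypothesis Ziid : iid Z.
Hypothesis Z_sq : ('E_P[fun w => (enorm (Z 0%N w) ^+ 2)%R] < +oo)%E.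

Let mu := vexpectation P (Z 0%N).
Let G w := enorm (Z 0%N w - mu).

Lemma measurable_centered : measurable_fun setT (fun z : R * R => z - mu).
Proof.
apply/measurable_fun_pairP; split => /=; apply: measurable_funB => //.
Qed.

Let m_dot u : measurable_fun setT (fun z : R * R => dot (z - mu) u).
Proof.
exact: (measurableT_comp (measurable_dot u) measurable_centered).
Qed.

Let m_enorm : measurable_fun setT (fun z : R * R => enorm (z - mu)).
Proof.
exact: (measurableT_comp (@measurable_enorm R) measurable_centered).
Qed.

Lemma enorm_Lfun2 : (fun w => enorm (Z 0%N w)) \in Lfun P 2%:E.
Proof.
have mZ : measurable_fun setT (fun w => enorm (Z 0%N w)).
  by apply: measurableT_comp => //; exact: measurable_enorm.
apply: sqr_Lfun2 => //; apply/integrableP; split.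
  by apply/measurable_EFinP; exact: measurable_funX.
move: Z_sq; rewrite unlock; apply: le_lt_trans; rewrite le_eqVlt.
apply/orP; left; apply/eqP; apply: eq_integral => w _.
by rewrite gee0_abs// lee_fin sqr_ge0.
Qed.

Lemma fst_Lfun2 : (fun w => (Z 0%N w).1) \in Lfun P 2%:E.
Proof.
apply: (le_Lfun2 _ _ enorm_Lfun2) => [|w].
  exact: (measurableT_comp measurable_fst).
rewrite (ger0_norm (enorm_ge0 _)) -sqrtr_sqr /enorm ler_wsqrtr//.
by rewrite /dot expr2 lerDl -expr2 sqr_ge0.
Qed.

Lemma snd_Lfun2 : (fun w => (Z 0%N w).2) \in Lfun P 2%:E.
Proof.
apply: (le_Lfun2 _ _ enorm_Lfun2) => [|w].
  exact: (measurableT_comp measurable_snd).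
rewrite (ger0_norm (enorm_ge0 _)) -sqrtr_sqr /enorm ler_wsqrtr//.
by rewrite /dot expr2 lerDr -expr2 sqr_ge0.
Qed.

Let G2 : G \in Lfun P 2%:E.
Proof.
apply: (le_Lfun2 _ _ (Lfun2D enorm_Lfun2 (Lfun2_cst P (enorm mu)))) => [|w].
  exact: (measurableT_comp m_enorm).
by rewrite !ger0_norm ?addr_ge0 ?enorm_ge0// enormB.
Qed.

Let dot2 u i : u \in axes R ->
  (fun z => dot (z - mu) u) \o Z i \in Lfun P 2%:E.
Proof.
move=> uA.
apply: (@identically_distributed_Lfun2 _ _ _ _ _ _ _ _ (proj2 Ziid) _ 0%N i
  (m_dot u)).
apply: (le_Lfun2 _ _ G2) => [|w].
  exact: (measurableT_comp (m_dot u)).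
by rewrite (ger0_norm (enorm_ge0 _)); exact: dot_axes_le.
Qed.

Let dot0 u i : \int[P]_w dot (Z i w - mu) u = 0.
Proof.
rewrite (identically_distributed_Rintegral (proj2 Ziid) i 0%N (m_dot u)).
rewrite /dot/=.
have i1 := Lfun2_integrable fst_Lfun2; have i2 := Lfun2_integrable snd_Lfun2.
have c1 := Lfun2_integrable (Lfun2_cst P mu.1).
have c2 := Lfun2_integrable (Lfun2_cst P mu.2).
have j1 := Rintegrable_sub i1 c1; have j2 := Rintegrable_sub i2 c2.
under eq_Rintegral do rewrite ![_ * u.1]mulrC ![_ * u.2]mulrC.
rewrite RintegralD//; try exact: Rintegrable_scale.
rewrite !RintegralZl// !RintegralB// !Rintegral_prob_cst.
by rewrite /mu/= unlock /Rintegral !subrr !mulr0 addr0.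
Qed.

(** A scalar majorant, up to [4 * l], for the norms of the centered sums of at most [k] steps
    starting at time [a]; each of the four directions contributes one [l]. *)
Definition walk_excess l a k w : R := \sum_(u <- axes R)
  excess l (fun i => dot (Z (a + i)%N w - mu) u) k.

Let excess2 u l a k : u \in axes R ->
  (fun w => excess l (fun i => dot (Z (a + i)%N w - mu) u) k)
  \in Lfun P 2%:E.
Proof.
move=> uA.
exact: (@excess_Lfun2 _ _ _ P _ _ Z (fun z => dot (z - mu) u)
  (fun i => dot2 i uA) a l k).
Qed.

Lemma walk_excess_Lfun2 l a k : walk_excess l a k \in Lfun P 2%:E.
Proof.
rewrite /walk_excess; under eq_fun do rewrite /axes !big_cons big_nil addr0.
by do 3?[apply: Lfun2D]; apply: excess2; rewrite !inE eqxx ?orbT.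
Qed.

Lemma walk_excess_ge0 l a k w : 0 <= walk_excess l a k w.
Proof. by apply: sumr_ge0 => u _; exact: excess_ge0. Qed.

Lemma enorm_walk_le l a k i w : 0 <= l -> (i <= k)%N ->
  enorm (\sum_(j < i) (Z (a + j)%N w - mu)) <= walk_excess l a k w + 4 * l.
Proof.
move=> l0 ik.
have -> : walk_excess l a k w + 4 * l = \sum_(u <- axes R)
    (excess l (fun i => dot (Z (a + i)%N w - mu) u) k + l).
  by rewrite /walk_excess /axes !big_cons !big_nil; ring.
apply: enorm_le_axes => [u|u _]; first by rewrite addr_ge0// excess_ge0.
by rewrite dot_suml; exact: (sum_le_excess _ l0 ik).
Qed.

Let s := \int[P]_w (G w ^+ 2).
(** This plays the role of [t] in the overshoot bound for all four directions at once, as [G]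
    dominates the projections of the centered step. *)
Let tail l := \int[P]_w (4 * Num.max 0 (G w - l / 4) ^+ 2).

Let s_ge0 : 0 <= s.
Proof. by apply: Rintegral_ge0 => w _; exact: sqr_ge0. Qed.

Let dot_s u i : u \in axes R -> \int[P]_w (dot (Z i w - mu) u ^+ 2) <= s.
Proof.
move=> uA.
have mX : measurable_fun setT (fun z : R * R => dot (z - mu) u ^+ 2).
  exact: measurable_funX.
rewrite (identically_distributed_Rintegral (proj2 Ziid) i 0%N mX).
apply: le_Rintegral => //; [exact: (Lfun2_sqr (dot2 0 uA))|exact: Lfun2_sqr|].
move=> w _; rewrite -real_normK ?num_real// ler_sqr ?nnegrE ?enorm_ge0//.
exact: dot_axes_le.
Qed.

Let tail_int (h : T -> R) l : h \in Lfun P 2%:E -> P.-integrable setT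
  (EFin \o (fun w => 4 * Num.max 0 (`|h w| - l / 4) ^+ 2)).
Proof.
move=> h2; apply: Rintegrable_scale; apply: Lfun2_sqr.
apply: Lfun2_max; [|apply: Lfun2B]; try exact: Lfun2_cst.
apply: (le_Lfun2 _ _ h2) => [|w]; last by rewrite normr_id.
by apply: measurableT_comp => //; exact: (Lfun2_measurable h2).
Qed.

Let dot_tail u i l : u \in axes R ->
  \int[P]_w (4 * Num.max 0 (`|dot (Z i w - mu) u| - l / 4) ^+ 2) <= tail l.
Proof.
move=> uA.
have mX : measurable_fun setT
    (fun z : R * R => 4 * Num.max 0 (`|dot (z - mu) u| - l / 4) ^+ 2).
  apply: measurable_funM => //; apply: measurable_funX.
  apply: measurable_maxr => //; apply: measurable_funB => //.
  exact: measurableT_comp.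
rewrite (identically_distributed_Rintegral (proj2 Ziid) i 0%N mX).
apply: le_Rintegral => //; first exact: (tail_int l (dot2 0 uA)).
  have := tail_int l G2.
  by under eq_fun do rewrite (ger0_norm (enorm_ge0 _)).
move=> w _; rewrite ler_pM2l//; apply: ler_sqr_pospart.
by rewrite lerB// dot_axes_le.
Qed.

(** The square of a sum of four terms is at most 4 times the sum of their squares, and each square
    has mean at most [c]; hence the factor 16. *)
Let walk_excess_sqr_le l a k c :
  (forall u, u \in axes R ->
    \int[P]_w (excess l (fun i => dot (Z (a + i)%N w - mu) u) k ^+ 2) <= c) ->
  \int[P]_w (walk_excess l a k w ^+ 2) <= 16 * c.
Proof.
move=> uc.
pose e u w := excess l (fun i => dot (Z (a + i)%N w - mu) u) k.
have ei u : u \in axes R -> P.-integrable setT (EFin \o (fun w => e u w ^+ 2)).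
  by move=> uA; apply: Lfun2_sqr; exact: excess2.
have [A1 A2 A3 A4] : [/\ (1, 0) \in axes R, (-1, 0) \in axes R,
  (0, 1) \in axes R & (0, -1) \in axes R].
  by split; rewrite !inE eqxx ?orbT.
have i12 := Rintegrable_add (ei _ A1) (ei _ A2).
have i34 := Rintegrable_add (ei _ A3) (ei _ A4).
have i1234 := Rintegrable_add i12 i34.
apply: (@le_trans _ _ (\int[P]_w (4 * ((e (1, 0) w ^+ 2 + e (-1, 0) w ^+ 2) +
   (e (0, 1) w ^+ 2 + e (0, -1) w ^+ 2))))).
  apply: le_Rintegral => //.
  - exact: (Lfun2_sqr (walk_excess_Lfun2 l a k)).
  - exact: Rintegrable_scale.
  move=> w _; rewrite /walk_excess /axes !big_cons big_nil addr0 -!/(e _ w).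
  move: (e (1, 0) w) (e (-1, 0) w) (e (0, 1) w) (e (0, -1) w) => x y z t.
  have := sqr_ge0 (x - y); have := sqr_ge0 (x - z); have := sqr_ge0 (x - t).
  have := sqr_ge0 (y - z); have := sqr_ge0 (y - t); have := sqr_ge0 (z - t).
  by nra.
rewrite RintegralZl// RintegralD// RintegralD//; [|exact: ei..].
rewrite RintegralD//; [|exact: ei..].
by have := uc _ A1; have := uc _ A2; have := uc _ A3; have := uc _ A4; lra.
Qed.

Lemma tail_cvg0 e : 0 < e ->
  exists l0, 0 < l0 /\ forall l, l0 <= l -> tail l <= e.
Proof.
move=> e0.
pose f n w := (4 * Num.max 0 (G w - n%:R / 4) ^+ 2)%:E.
have ti l : P.-integrable setT
    (EFin \o (fun w => 4 * Num.max 0 (G w - l / 4) ^+ 2)).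
  have := tail_int l G2.
  by under eq_fun do rewrite (ger0_norm (enorm_ge0 _)).
have fcvg : (\int[P]_w f n w)%E @[n --> \oo] --> (\int[P]_w (cst 0%E w))%E.
  apply: (@dominated_cvg _ _ _ _ _ _ f (cst 0%E)
    (fun w => (4 * G w ^+ 2)%:E)) => //.
  - by move=> n; move/integrableP : (ti n%:R) => [].
  (* For fixed [w] the integrand vanishes as soon as [n >= 4 * G w]. *)
  - move=> w _; apply: cvg_near_cst; near=> n.
    rewrite /f max_l ?expr0n ?mulr0//.
    rewrite subr_le0 ler_pdivlMr//.
    by near: n; exact: nbhs_infty_ger.
  - by apply: Rintegrable_scale; exact: Lfun2_sqr.
  - move=> n w _; rewrite /f lee_fin ger0_norm; last first.
      by rewrite pmulr_rge0// sqr_ge0.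
    rewrite ler_pM2l// -[X in _ <= X ^+ 2](max_r (enorm_ge0 _ : 0 <= G w)).
    by apply: ler_sqr_pospart; rewrite gerBl divr_ge0.
have := fcvg [set y : \bar R | (y < e%:E)%E]; rewrite integral0.
move=> /(_ (@nbhs_open_ereal_lt _ 0 (fun=> e) e0)).
(* The tail decreases in [l], so smallness at one integer passes to all larger levels; the successor
   makes the threshold positive. *)
move=> [n _ nP]; exists n.+1%:R; split => // l nl.
have := nP n (leqnn n) => /= fn.
have tn : tail n%:R < e.
  rewrite -lte_fin /tail /Rintegral fineK//.
  exact: (integrable_fin_num measurableT (ti n%:R)).
apply: (le_trans _ (ltW tn)); apply: le_Rintegral => // w _.
rewrite ler_pM2l//; apply: ler_sqr_pospart.
rewrite lerD2l lerN2 ler_pM2r//; apply: le_trans nl.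
by rewrite ler_nat.
Unshelve. all: end_near. Qed.

Lemma walk_excess0_sqr : exists s0, 0 <= s0 /\ forall a k,
  \int[P]_w (walk_excess 0 a k w ^+ 2) <= k%:R * s0.
Proof.
exists (16 * (4 * s)); split; first by rewrite !mulr_ge0.
move=> a k; have -> : k%:R * (16 * (4 * s)) = 16 * (4 * (k%:R * s)) by ring.
apply: walk_excess_sqr_le => u uA.
apply: (@excess0_sqr _ _ _ P _ _ Z (fun z => dot (z - mu) u)
  (proj1 Ziid) (m_dot u) (fun i => dot2 i uA) (fun i => dot0 u i) a s) => i.
exact: dot_s.
Qed.

Lemma walk_excess_sqr_small c e : 0 < c -> 0 < e -> exists n0, forall n,
  (n0 <= n)%N -> \int[P]_w (walk_excess (c * n%:R) 0 n w ^+ 2) <= n%:R * e.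
Proof.
move=> c0 e0.
(* The tail enters the final bound with the factor [16 * 4 * n], so a tail of at most [e / 128]
   contributes [n e / 2]. The constant [C] collects what the quadratic term leaves at the level
   [c n]. *)
have [l0 [l00 tl0]] := tail_cvg0 (divr_gt0 e0 (ltr0Sn R 127)).
pose C := 16 * (4 * (4 * (s / c) ^+ 2)).
(* The first threshold makes the level [c n] exceed [l0], the second one gives [C <= n e / 2]. *)
pose n0 := maxn (Num.truncn (l0 / c)).+1 (Num.truncn (2 * C / e)).+1.
exists n0 => n; rewrite geq_max => /andP[n1 n2].
have npos : 0 < n%:R :> R by rewrite ltr0n (leq_trans _ n1).
have nl : l0 <= c * n%:R.
  rewrite mulrC -ler_pdivrMr// (le_trans (ltW (truncnS_gt _)))//.
  by rewrite ler_nat.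
have nC : C <= n%:R * e / 2.
  have : 2 * C / e <= n%:R.
    by rewrite (le_trans (ltW (truncnS_gt _)))// ler_nat.
  by rewrite ler_pdivrMr//; lra.
apply: (@le_trans _ _ (16 * (4 * (n%:R * (4 * n%:R * (s / (c * n%:R)) ^+ 2 +
  e / 128))))).
  apply: walk_excess_sqr_le => u uA.
  apply: (@excess_sqr _ _ _ P _ _ Z (fun z => dot (z - mu) u)
    (proj1 Ziid) (m_dot u) (fun i => dot2 i uA) (fun i => dot0 u i) 0 s)
    => [|i|i].
  - by rewrite mulr_gt0.
  - exact: dot_s.
  - by apply: le_trans (tl0 _ nl); exact: dot_tail.
have -> : 16 * (4 * (n%:R * (4 * n%:R * (s / (c * n%:R)) ^+ 2 + e / 128))) =
   C + n%:R * e / 2.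
  by rewrite /C; field; rewrite !gt_eqF.
by move: nC; lra.
Qed.

End walk_bound.

(** * The diameter of a convex hull *)

Section hull_diameter.
Variable R : realType.
Implicit Types (u v p x y : R * R) (A : set (R * R)) (c : R).

Lemma convex_set_ball p c :
  @convex_set R (R * R)%type [set x | enorm (x - p) <= c].
Proof.
move=> x y l; rewrite !inE/= => xc yc.
set a := l%:num.
have a0 : 0 <= a by rewrite /a ge0.
have a1 : 0 <= 1 - a by rewrite subr_ge0 /a le1.
have -> : conv l x y - p = a *: (x - p) + (1 - a) *: (y - p).
  rewrite -[conv l x y]/(a *: x + (1 - a) *: y) !scalerBr.
  by rewrite addrACA -opprD -scalerDl addrC [a + _]addrC subrK scale1r addrC.
apply: (le_trans (enormD _ _)); rewrite !enormZ !ger0_norm//.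
by nra.
Qed.

(** Balls are convex, so the hull lies in the ball of radius [c] around each point of [A]. Hence
    [A], and then its hull, lies in the ball of radius [c] around each point of the hull. *)
Lemma hull_dist_le A c : (forall x y, A x -> A y -> enorm (x - y) <= c) ->
  forall x y, convex_hull A x -> convex_hull A y -> enorm (x - y) <= c.
Proof.
move=> Ac.
have step y : A y -> convex_hull A `<=` [set x | enorm (x - y) <= c].
  move=> Ay; apply: smallest_sub; first exact: convex_set_ball.
  by move=> x Ax; exact: Ac.
move=> x y hx; move: y.
rewrite -/(convex_hull A `<=` [set y | enorm (x - y) <= c]).
apply: smallest_sub.
  under eq_set do rewrite enorm_distC; exact: convex_set_ball.
by move=> y Ay; exact: step.
Qed.

Lemma diameter_hull_le A c : A !=set0 ->
  (forall x y, A x -> A y -> enorm (x - y) <= c) ->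
  diameter (convex_hull A) <= c.
Proof.
move=> [a Aa] Ac; apply: ge_sup.
  by exists (enorm (a - a)), (a, a) => //; split; exact: sub_gen_smallest.
by move=> _ [[x y] [/= hx hy] <-]; exact: (hull_dist_le Ac).
Qed.

(** The common bound [c] makes the set of distances bounded, so that [sup] is a genuine supremum and
    not a default value. *)
Lemma le_diameter_hull A c x y :
  (forall x y, A x -> A y -> enorm (x - y) <= c) -> A x -> A y ->
  enorm (x - y) <= diameter (convex_hull A).
Proof.
move=> Ac Ax Ay; apply: ub_le_sup.
  by exists c => _ [[x' y'] [/= hx hy] <-]; exact: (hull_dist_le Ac).
by exists (x, y) => //; split; exact: sub_gen_smallest.
Qed.

End hull_diameter.

(** * Deterministic bound on the distance between two points of the walks *)

Section pair_bound.
Variable R : realType.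
Implicit Types (u v : R * R) (S : nat -> R * R).

Lemma pair_ext u v : u.1 = v.1 -> u.2 = v.2 -> u = v.
Proof. by case: u v => [a b] [c e] /= -> ->. Qed.

Lemma dot_shift u v (t : R) : dot v v = 1 ->
  dot (u + t *: v) (u + t *: v) =
  (dot u v + t) ^+ 2 + (dot u u - dot u v ^+ 2).
Proof.
rewrite /dot/= /GRing.scale/= => h.
transitivity (u.1 * u.1 + u.2 * u.2 + 2 * t * (u.1 * v.1 + u.2 * v.2) +
   t ^+ 2 * (v.1 * v.1 + v.2 * v.2)); first by ring.
by rewrite h; ring.
Qed.

Variables (S1 : nat -> R * R) (mu1 e : R * R) (m dlt M Q : R) (n k : nat).
Hypothesis e1 : enorm e = 1.
Hypothesis mu1E : mu1 = m *: e.
Hypothesis dlt0 : 0 < dlt.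
Hypothesis dltm : dlt <= m.
Hypothesis n0 : (0 < n)%N.
Hypothesis kn : (k <= n)%N.
Hypothesis Q0 : 0 <= Q.
Hypothesis SM : forall j, (j <= n)%N -> enorm (S1 j - j%:R *: mu1) <= M.
Hypothesis SQ : forall j, (n - k <= j <= n)%N ->
  enorm ((S1 n - n%:R *: mu1) - (S1 j - j%:R *: mu1)) <= Q.

Let X := dot (S1 n) e.
Let m0 : 0 < m. Proof. exact: lt_le_trans dltm. Qed.
Let nR0 : 0 < n%:R :> R. Proof. by rewrite ltr0n. Qed.
Let M0 : 0 <= M. Proof. exact: le_trans (enorm_ge0 _) (SM (leqnn n)). Qed.
Let r := k%:R / n%:R : R.
Let r0 : 0 <= r. Proof. by rewrite divr_ge0. Qed.

Let dotee : dot e e = 1. Proof. by rewrite -enorm_sqr e1 expr1n. Qed.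

Let mu1N : enorm mu1 = m.
Proof. by rewrite mu1E enormZ e1 mulr1 ger0_norm// ltW. Qed.

Lemma dot_walk_ge : n%:R * m - M <= X.
Proof.
have := le_trans (ler_dot (S1 n - n%:R *: mu1) e) _.
move=> /(_ M); rewrite e1 mulr1 => /(_ (SM (leqnn n))).
rewrite dotBl mu1E !dotZl dotee mulr1 ler_norml -/X => /andP[+ _].
by rewrite lerBrDl => /le_trans; apply; lra.
Qed.

(** The component of [S1 n] orthogonal to [e] comes from the fluctuation alone, so $|S_n|^2 \le X^2
    + M^2$ by Pythagoras, and $M^2 \le 2 X r M$. *)
Lemma enorm_walk_le_dot : 3 * M <= k%:R * dlt -> enorm (S1 n) <= X + r * M.
Proof.
move=> good.
have hX := dot_walk_ge.
have kd : k%:R * dlt <= n%:R * m by rewrite ler_pM// ?ler_nat// ltW.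
have nm0 : 0 < n%:R * m by rewrite mulr_gt0.
have X0 : 0 <= X by lra.
have XrM : 0 <= X + r * M by apply: addr_ge0 => //; exact: mulr_ge0.
rewrite enorm_le//.
set W := S1 n - n%:R *: mu1.
have WM : dot W W <= M ^+ 2.
  by rewrite -enorm_sqr ler_sqr ?nnegrE ?enorm_ge0 ?SM.
have SE : S1 n = W + (n%:R * m) *: e by rewrite /W mu1E scalerA subrK.
have XE : X = dot W e + n%:R * m by rewrite /X SE dotDl dotZl dotee mulr1.
have -> : dot (S1 n) (S1 n) = X ^+ 2 + (dot W W - dot W e ^+ 2).
  by rewrite XE SE; exact: dot_shift.
have h1 : dot W W - dot W e ^+ 2 <= M ^+ 2.
  by apply: le_trans WM; rewrite gerBl sqr_ge0.
(* From [3 M <= k dlt <= k m] and [X >= n m - M] one gets [X >= 2 n m / 3], so [2 X r >= 4 k m / 3],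
   which exceeds [M]. *)
have h2 : M <= 2 * X * r.
  rewrite /r mulrA ler_pdivlMr//.
  have : 2 / 3 * (n%:R * m) <= X by lra.
  have kR := ler0n R k.
  have h3 : k%:R * dlt <= k%:R * m by exact: ler_wpM2l.
  have /(ler_wpM2r (ltW nR0)) h4 : M <= k%:R * m / 3 by lra.
  move=> /(ler_wpM2l kR) h5; have h6 : 0 <= k%:R * X by exact: mulr_ge0.
  by lra.
have := sqr_ge0 (r * M); have := ler_wpM2r M0 h2; lra.
Qed.

Lemma far_pair_le v v' S S' i j :
  (forall j, (j <= n)%N -> enorm (S j - j%:R *: v) <= M) ->
  (forall j, (j <= n)%N -> enorm (S' j - j%:R *: v') <= M) ->
  (i <= n)%N -> (j <= n)%N ->
  enorm (S j - S' i) <= enorm (j%:R *: v - i%:R *: v') + 2 * M.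
Proof.
move=> hS hS' iN jN.
have -> : S j - S' i = (j%:R *: v - i%:R *: v') +
    ((S j - j%:R *: v) - (S' i - i%:R *: v')).
  by apply: pair_ext => /=; ring.
apply: (le_trans (enormD _ _)); rewrite lerD2l.
apply: (le_trans (enormB _ _)).
by have := hS _ jN; have := hS' _ iN; lra.
Qed.

(* Write [c = n - t] for the number of missing steps. If [c > k], the drift lost
   is at least [k dlt]; otherwise [S1 (i + t) - S i] is close to
   [(t / n) *: S1 n + i *: (mu1 - v)], no longer than [S1 n]. *)
Lemma near_pair_le v S i t : (i + t <= n)%N ->
  enorm (mu1 - v) <= m - dlt ->
  (forall j, (j <= n)%N -> enorm (S j - j%:R *: v) <= M) ->
  (forall j, (j <= k)%N -> enorm (S j - j%:R *: v) <= Q) ->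
  3 * M <= k%:R * dlt ->
  enorm (S1 (i + t) - S i) <= X + 2 * Q + 2 * (r * M).
Proof.
move=> itn v_le hM hQ good.
have iN : (i <= n)%N by exact: leq_trans (leq_addr _ _) itn.
have hX := dot_walk_ge.
have [u uE] : exists u : nat, u = (n - (i + t))%N by eexists.
have [D DE] : exists D : R * R, D = mu1 - v by eexists.
rewrite -DE in v_le.
have nE : n%:R = i%:R + t%:R + u%:R :> R by rewrite -!natrD uE subnKC.
have iR := ler0n R i; have tR := ler0n R t; have uR := ler0n R u.
have rM : 0 <= r * M by rewrite mulr_ge0.
have [c_le|c_gt] := leqP (u + i) k; last first.
  have cR : k%:R <= u%:R + i%:R :> R by rewrite -natrD ler_nat ltnW.
  apply: (le_trans (far_pair_le SM hM iN itn)).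
  have -> : (i + t)%:R *: mu1 - i%:R *: v = i%:R *: D + t%:R *: mu1.
    by rewrite natrD DE; apply: pair_ext => /=; rewrite /GRing.scale/=; ring.
  have a0 : enorm (i%:R *: D + t%:R *: mu1) <= i%:R * enorm D + t%:R * m.
    by apply: (le_trans (enormD _ _)); rewrite !enormZ mu1N !ger0_norm.
  have h1 : i%:R * enorm D <= i%:R * (m - dlt) by exact: ler_wpM2l.
  have h2 : u%:R * dlt <= u%:R * m by exact: ler_wpM2l.
  have h3 : k%:R * dlt <= (u%:R + i%:R) * dlt by rewrite ler_wpM2r// ltW.
  apply: (@le_trans _ _ (i%:R * enorm D + t%:R * m + 2 * M)).
    by rewrite lerD2r; exact: a0.
  by rewrite nE in hX; have := Q0; lra.
have iK : (i <= k)%N by exact: leq_trans (leq_addl _ _) c_le.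
have tn : (n - k <= i + t <= n)%N.
  rewrite itn andbT leq_subCl -uE; exact: leq_trans (leq_addr _ _) c_le.
have [w wE] : exists w : R * R, w = S1 n - n%:R *: mu1 by eexists.
have [x xE] : exists x : R * R, x = S i - i%:R *: v by eexists.
have [y yE] : exists y : R * R,
  y = (S1 n - n%:R *: mu1) - (S1 (i + t)%N - (i + t)%:R *: mu1) by eexists.
have wM : enorm w <= M by rewrite wE SM.
have xQ : enorm x <= Q by rewrite xE hQ.
have yQ : enorm y <= Q by rewrite yE SQ.
(* The error consists of the share [(u + i) / n] of the fluctuation [w] of [S1 n], which costs at
   most [r M], and of two fluctuations over at most [k] steps. *)
have -> : S1 (i + t)%N - S i = (i%:R *: D + (t%:R / n%:R) *: S1 n) +
    (((u%:R + i%:R) / n%:R) *: w - (y + x)).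
  have nn0 : i%:R + t%:R + u%:R != 0 :> R by rewrite -nE gt_eqF.
  rewrite xE yE wE DE natrD nE.
  by apply: pair_ext => /=; rewrite /GRing.scale/=; field.
apply: (le_trans (enormD _ _)).
have a1 : enorm (i%:R *: D + (t%:R / n%:R) *: S1 n) <=
    i%:R * enorm D + t%:R / n%:R * enorm (S1 n).
  by apply: (le_trans (enormD _ _)); rewrite !enormZ !ger0_norm ?divr_ge0.
have a2 : enorm (((u%:R + i%:R) / n%:R) *: w - (y + x)) <=
    (u%:R + i%:R) / n%:R * enorm w + (Q + Q).
  apply: (le_trans (enormB _ _)); apply: lerD.
    by rewrite enormZ ger0_norm// divr_ge0// addr_ge0.
  by apply: (le_trans (enormD _ _)); exact: lerD.
apply: (le_trans (lerD a1 a2)).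
have b3 : (u%:R + i%:R) / n%:R * enorm w <= r * M.
  apply: ler_pM; rewrite ?enorm_ge0 ?divr_ge0 ?addr_ge0//.
  by rewrite ler_wpM2r ?invr_ge0// -natrD ler_nat.
(* This yields [enorm D <= enorm (S1 n) / n], so the term in [D] is absorbed by the share [i / n] of
   the length of [S1 n]. *)
have S1ge : n%:R * (m - dlt) <= enorm (S1 n).
  have h1 : X <= enorm (S1 n).
    by apply: le_trans (ler_norm _) _; rewrite -[leRHS]mulr1 -e1 ler_dot.
  have h2 : k%:R * dlt <= n%:R * dlt by rewrite ler_wpM2r ?ler_nat// ltW.
  by have := M0; lra.
have b4 : i%:R * enorm D <= i%:R / n%:R * enorm (S1 n).
  rewrite -mulrA; apply: ler_wpM2l => //; apply: (le_trans v_le).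
  by rewrite mulrC ler_pdivlMr// mulrC.
have b5 : i%:R / n%:R * enorm (S1 n) + t%:R / n%:R * enorm (S1 n) <=
    enorm (S1 n).
  rewrite -mulrDl -mulrDl -[leRHS]mul1r ler_wpM2r ?enorm_ge0//.
  by rewrite ler_pdivrMr// mul1r -natrD ler_nat.
have b6 := enorm_walk_le_dot good.
by have := Q0; lra.
Qed.

Let c := X + (2 * Q + 2 * (r * M) + 6 * Num.max 0 (M - k%:R * dlt / 6)).

(** Since [X >= n m - M], it suffices that [3 M] is at most [n dlt] plus the positive part in [c].
    This is clear if [M <= k dlt / 6]; otherwise that part is [6 M - k dlt], and [k <= n]. *)
Let far_le_c (z : R) : z <= n%:R * (m - dlt) -> z + 2 * M <= c.
Proof.
move=> zle; have hX := dot_walk_ge; rewrite /c.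
have h1 : k%:R * dlt <= n%:R * dlt by rewrite ler_wpM2r ?ler_nat// ltW.
have h2 : 0 <= r * M by rewrite mulr_ge0.
have h3 : 0 <= n%:R * dlt by rewrite mulr_ge0// ltW.
by have := Q0; have := M0; have [p|p] := leP 0 (M - k%:R * dlt / 6); lra.
Qed.

(** Used with [S = S1] for pairs on the first walk, and with [S = S2] for mixed pairs where the
    first walk has the later time. *)
Lemma ordered_pair_le v S i j : (i <= j <= n)%N ->
  enorm (mu1 - v) <= m - dlt ->
  (forall j, (j <= n)%N -> enorm (S j - j%:R *: v) <= M) ->
  (forall j, (j <= k)%N -> enorm (S j - j%:R *: v) <= Q) ->
  enorm (S1 j - S i) <= c.
Proof.
move=> /andP[ij jn] v_le hM hQ.
have hX := dot_walk_ge; have h0 : 0 <= r * M by rewrite mulr_ge0.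
have [t jE] : exists t, j = (i + t)%N by exists (j - i)%N; rewrite subnKC.
rewrite jE in jn *.
(* If [k dlt < 3 M], the crude bound [n m + 2 M] suffices: it exceeds [X] by at most [3 M], which is
   less than [6 (M - k dlt / 6)]. *)
have [good|bad] := leP (3 * M) (k%:R * dlt).
  apply: (le_trans (near_pair_le jn v_le hM hQ good)); rewrite /c -/X.
  by have [p|p] := leP 0 (M - k%:R * dlt / 6); lra.
have iN : (i <= n)%N by exact: leq_trans (leq_addr _ _) jn.
apply: (le_trans (far_pair_le SM hM iN jn)).
have a0 : enorm ((i + t)%:R *: mu1 - i%:R *: v) <= n%:R * m.
  have -> : (i + t)%:R *: mu1 - i%:R *: v = i%:R *: (mu1 - v) + t%:R *: mu1.
    by rewrite natrD; apply: pair_ext => /=; rewrite /GRing.scale/=; ring.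
  apply: (le_trans (enormD _ _)); rewrite !enormZ mu1N !ger0_norm//.
  apply: (@le_trans _ _ ((i + t)%:R * m)); last first.
    by rewrite ler_wpM2r ?ler_nat// ltW.
  rewrite natrD mulrDl lerD2r; apply: ler_wpM2l => //.
  by apply: (le_trans v_le); have := dlt0; lra.
apply: (@le_trans _ _ (n%:R * m + 2 * M)); first by rewrite lerD2r.
rewrite /c; have := Q0; have [p|p] := leP 0 (M - k%:R * dlt / 6); lra.
Qed.

Variables (S2 : nat -> R * R) (mu2 : R * R).
Hypothesis mu2_le : enorm mu2 <= m - dlt.
Hypothesis mu12_le : enorm (mu1 - mu2) <= m - dlt.
Hypothesis SM2 : forall j, (j <= n)%N -> enorm (S2 j - j%:R *: mu2) <= M.
Hypothesis SQ1 : forall j, (j <= k)%N -> enorm (S1 j - j%:R *: mu1) <= Q.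
Hypothesis SQ2 : forall j, (j <= k)%N -> enorm (S2 j - j%:R *: mu2) <= Q.

Let md0 : 0 <= m - dlt. Proof. exact: le_trans (enorm_ge0 _) mu2_le. Qed.

Let pair11 i j : (i <= n)%N -> (j <= n)%N -> enorm (S1 j - S1 i) <= c.
Proof.
move=> iN jN; wlog ij : i j iN jN / (i <= j)%N => [h|].
  by case/orP: (leq_total i j) => ij; [|rewrite enorm_distC]; exact: h.
by apply: (ordered_pair_le (v := mu1)); rewrite ?ij ?subrr ?enorm0.
Qed.

Let pair12 i j : (i <= n)%N -> (j <= n)%N -> enorm (S1 j - S2 i) <= c.
Proof.
move=> iN jN; have [ij|ji] := leqP i j.
  by apply: (ordered_pair_le (v := mu2)); rewrite ?ij.
apply: (le_trans (far_pair_le SM SM2 iN jN)); apply: far_le_c.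
have [t iE] : exists t, i = (j + t)%N.
  by exists (i - j)%N; rewrite subnKC// ltnW.
(* Both drifts on the right have length at most [m - dlt], and their coefficients add up to
   [i <= n]. *)
have -> : j%:R *: mu1 - i%:R *: mu2 = j%:R *: (mu1 - mu2) - t%:R *: mu2.
  by rewrite iE natrD; apply: pair_ext => /=; rewrite /GRing.scale/=; ring.
apply: (le_trans (enormB _ _)); rewrite !enormZ !ger0_norm//.
apply: (@le_trans _ _ (i%:R * (m - dlt))).
  by rewrite iE natrD mulrDl; apply: lerD; apply: ler_wpM2l.
by rewrite ler_wpM2r// ler_nat.
Qed.

Let pair22 i j : (i <= n)%N -> (j <= n)%N -> enorm (S2 j - S2 i) <= c.
Proof.
move=> iN jN; wlog ij : i j iN jN / (i <= j)%N => [h|].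
  by case/orP: (leq_total i j) => ij; [|rewrite enorm_distC]; exact: h.
apply: (le_trans (far_pair_le SM2 SM2 iN jN)); apply: far_le_c.
rewrite -scalerBl -natrB// enormZ ger0_norm//.
apply: ler_pM; rewrite ?enorm_ge0 ?ler_nat//.
exact: leq_trans (leq_subr _ _) jN.
Qed.

Lemma walks_pair_le x y :
  let A := [set S1 j | j in [set j | (j <= n)%N]] `|`
           [set S2 j | j in [set j | (j <= n)%N]] in
  A x -> A y -> enorm (x - y) <=
  dot (S1 n) e + (2 * Q + 2 * (k%:R / n%:R * M) +
                  6 * Num.max 0 (M - k%:R * dlt / 6)).
Proof.
rewrite -/r -/X -/c /=.
move=> [[i iN <-]|[i iN <-]] [[j jN <-]|[j jN <-]].
- exact: pair11.
- exact: pair12.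
- by rewrite enorm_distC; exact: pair12.
- exact: pair22.
Qed.

End pair_bound.

(** * Estimates of second moments and convergence in $L^2$ *)

Section second_moment.
Context d (T : measurableType d) (R : realType) (P : probability T R).
Implicit Types (f g : T -> R) (a b c : R).

Lemma sqr_addD_le f g a b : f \in Lfun P 2%:E -> g \in Lfun P 2%:E ->
  \int[P]_w (f w ^+ 2) <= a -> \int[P]_w (g w ^+ 2) <= b ->
  \int[P]_w ((f w + g w) ^+ 2) <= 2 * (a + b).
Proof.
move=> f2 g2 fa gb; have fi := Lfun2_sqr f2; have gi := Lfun2_sqr g2.
apply: (@le_trans _ _ (\int[P]_w (2 * (f w ^+ 2 + g w ^+ 2)))).
  apply: le_Rintegral => //; first exact: (Lfun2_sqr (Lfun2D f2 g2)).
    by apply: Rintegrable_scale; exact: Rintegrable_add.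
  by move=> w _; have := sqr_ge0 (f w - g w); lra.
rewrite RintegralZl//; last exact: Rintegrable_add.
by rewrite RintegralD// ler_pM2l//; exact: lerD.
Qed.

Lemma sqr_scale_le f a c : f \in Lfun P 2%:E ->
  \int[P]_w (f w ^+ 2) <= a -> \int[P]_w ((c * f w) ^+ 2) <= c ^+ 2 * a.
Proof.
move=> f2 fa; under eq_Rintegral do rewrite exprMn.
by rewrite RintegralZl ?ler_wpM2l ?sqr_ge0//; exact: Lfun2_sqr.
Qed.

Lemma Lfun2_scale c f : f \in Lfun P 2%:E -> (fun w => c * f w) \in Lfun P 2%:E.
Proof.
move=> f2; have -> : (fun w => c * f w) = c \o* f.
  by apply/funext => w /=; rewrite mulrC.
by apply: Lfun_scale => //; rewrite ler1n.
Qed.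

Lemma centered_sqr_le f : f \in Lfun P 2%:E ->
  \int[P]_w ((f w - \int[P]_x f x) ^+ 2) <= \int[P]_w (f w ^+ 2).
Proof.
move=> f2; set c := \int[P]_x f x.
have fi := Lfun2_integrable f2; have f2i := Lfun2_sqr f2.
have ci := Lfun2_integrable (Lfun2_cst P (c ^+ 2)).
have E : \int[P]_w ((f w - c) ^+ 2) =
    \int[P]_w (f w ^+ 2 - (2 * c) * f w + c ^+ 2).
  by apply: eq_Rintegral => w _; ring.
have fci := Rintegrable_scale (2 * c) fi.
have fb := Rintegrable_sub f2i fci.
rewrite E RintegralD// RintegralB// RintegralZl// Rintegral_prob_cst -/c.
by have := sqr_ge0 c; lra.
Qed.

Lemma Lnorm2_cvg0 (f : nat -> T -> R) : (forall n, f n \in Lfun P 2%:E) ->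
  (forall e, 0 < e -> exists n0, forall n, (n0 <= n)%N ->
    \int[P]_w (f n w ^+ 2) <= e) ->
  Lnorm P 2%:E (fun w => (f n w)%:E) @[n --> \oo] --> 0%E.
Proof.
move=> f2 small.
have NE n : Lnorm P 2%:E (fun w => (f n w)%:E) =
    (Num.sqrt (\int[P]_w (f n w ^+ 2)))%:E.
  rewrite (Lnorm2E P (f n)) -[X in (X `^ _)%E]fineK; last first.
    exact: (integrable_fin_num measurableT (Lfun2_sqr (f2 n))).
  rewrite poweR_EFin powR12_sqrt//.
  by apply: Rintegral_ge0 => w _; exact: sqr_ge0.
under eq_fun do rewrite NE.
apply: cvg_EFin; first by exact: nearW.
have c0 : (\int[P]_w (f n w ^+ 2)) @[n --> \oo] --> (0 : R).
  apply/cvgrPdist_le => e e0; have [n0 h] := small _ e0.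
  exists n0 => // n /= nn0; rewrite sub0r normrN ger0_norm; first exact: h.
  by apply: Rintegral_ge0 => w _; exact: sqr_ge0.
rewrite -[X in _ --> X](@sqrtr0 R).
apply: (@cvg_comp _ _ _ _ _ _ _ _ c0 (@sqrt_continuous R 0)).
Qed.

End second_moment.

(** * The diameter spanned by the two walks *)

Section two_walks.
Context d (T : measurableType d) (R : realType) (P : probability T R).
Variables Z1 Z2 : nat -> {RV P >-> (R * R)%type}.
Hypotheses (iidZ1 : iid Z1) (iidZ2 : iid Z2).
Hypothesis Z1_sq : ('E_P[fun w => (enorm (Z1 0%N w) ^+ 2)%R] < +oo)%E.
Hypothesis Z2_sq : ('E_P[fun w => (enorm (Z2 0%N w) ^+ 2)%R] < +oo)%E.

Let mu1 := vexpectation P (Z1 0%N).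
Let mu2 := vexpectation P (Z2 0%N).
Let D := walks_diameter Z1 Z2.

Variables (m dlt : R) (e : R * R).
Hypothesis e1 : enorm e = 1.
Hypothesis mu1E : mu1 = m *: e.
Hypothesis dlt0 : 0 < dlt.
Hypothesis dltm : dlt <= m.
Hypothesis mu2_le : enorm mu2 <= m - dlt.
Hypothesis mu12_le : enorm (mu1 - mu2) <= m - dlt.

Let X n w := dot (walk Z1 n w) e.
Let G n w := D n w - X n w.

Let points n w := [set walk Z1 j w | j in [set j | (j <= n)%N]] `|`
                  [set walk Z2 j w | j in [set j | (j <= n)%N]].

Lemma walk_centered (Z : nat -> {RV P >-> (R * R)%type}) (mu : R * R) a j w :
  (walk Z (a + j) w - (a + j)%:R *: mu) - (walk Z a w - a%:R *: mu) =
  \sum_(i < j) (Z (a + i)%N w - mu).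
Proof.
rewrite /walk big_split_ord/= sumrB sumr_const card_ord -scaler_nat natrD.
rewrite scalerDl.
move: (\sum_(i < a) _) (\sum_(i < j) _) => u v.
by apply: pair_ext => /=; rewrite /GRing.scale/=; ring.
Qed.

Lemma walk_centered0 (Z : nat -> {RV P >-> (R * R)%type}) (mu : R * R) j w :
  walk Z j w - j%:R *: mu = \sum_(i < j) (Z (0 + i)%N w - mu).
Proof.
have W0 : walk Z 0 w = 0 by rewrite /walk big_ord0.
by have := walk_centered Z mu 0 j w; rewrite add0n W0 scale0r !subr0.
Qed.

Section deterministic.
Variables (n k : nat) (l : R) (w : T).
Hypothesis n0 : (0 < n)%N.
Hypothesis kn : (k <= n)%N.
Hypothesis l0 : 0 <= l.
Hypothesis lk : 4 * l <= k%:R * dlt / 6.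

Let B1 := walk_excess Z1.
Let B2 := walk_excess Z2.
(** The factor 2 is due to the increments of the first walk over [[j, n]], which are differences of
    two sums started at time [n - k]. *)
Let Q := 2 * B1 0 (n - k) k w + (B1 0 0 k w + B2 0 0 k w).
Let Ml := B1 l 0 n w + B2 l 0 n w.
Let M0 := B1 0 0 n w + B2 0 0 n w.
(* Both terms bound the fluctuations; the first is used for the linear
   occurrence of [M], the second one inside [(M - k dlt / 6)_+]. *)
Let M := Num.min M0 (Ml + 4 * l).

Let B10 l' a j : 0 <= B1 l' a j w. Proof. exact: walk_excess_ge0. Qed.
Let B20 l' a j : 0 <= B2 l' a j w. Proof. exact: walk_excess_ge0. Qed.

(** The level [4 * l] is at most [k dlt / 6], so the positive part of the pair bound is at most the
    overshoot [Ml]. *)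
Lemma points_dist_le x y : points n w x -> points n w y ->
  enorm (x - y) <=
  X n w + (2 * Q + 2 * (k%:R / n%:R * M0) + 6 * Ml).
Proof.
move=> hx hy.
have H1 l' a j i : 0 <= l' -> (i <= j)%N ->
    enorm (\sum_(t < i) (Z1 (a + t)%N w - mu1)) <= B1 l' a j w + 4 * l'.
  exact: enorm_walk_le.
have H2 l' a j i : 0 <= l' -> (i <= j)%N ->
    enorm (\sum_(t < i) (Z2 (a + t)%N w - mu2)) <= B2 l' a j w + 4 * l'.
  exact: enorm_walk_le.
have Q0 : 0 <= Q by rewrite !addr_ge0// mulr_ge0.
have := @walks_pair_le R (walk Z1 ^~ w) mu1 e m dlt M Q n k e1 mu1E dlt0 dltm
  n0 kn Q0 _ _ (walk Z2 ^~ w) mu2 mu2_le mu12_le _ _ _ x y hx hy.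
move=> /(_ _ _ _ _ _)/le_trans; apply.
- move=> j jn; rewrite walk_centered0 /M le_min; apply/andP; split.
    have := H1 0 0%N n j (lexx _) jn; rewrite mulr0 addr0 => /le_trans; apply.
    by rewrite lerDl.
  have := H1 l 0%N n j l0 jn; move=> /le_trans; apply.
  by rewrite lerD2r lerDl.
- move=> j /andP[j1 j2].
  have [t jE] : exists t, j = (n - k + t)%N.
    by exists (j - (n - k))%N; rewrite subnKC.
  have tk : (t <= k)%N by rewrite -(leq_add2l (n - k)) -jE subnK.
  have -> : walk Z1 n w - n%:R *: mu1 - (walk Z1 j w - j%:R *: mu1) =
     \sum_(i < k) (Z1 (n - k + i)%N w - mu1) -
     \sum_(i < t) (Z1 (n - k + i)%N w - mu1).
    rewrite -!walk_centered subnK// -jE.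
    by apply: pair_ext => /=; ring.
  apply: (le_trans (enormB _ _)).
  have h1 := H1 0 (n - k)%N k k (lexx _) (leqnn _).
  have h2 := H1 0 (n - k)%N k t (lexx _) tk.
  rewrite mulr0 addr0 in h1 h2.
  apply: (le_trans (lerD h1 h2)); rewrite /Q.
  by have := B10 0 0 k; have := B20 0 0 k; lra.
- move=> j jn; rewrite walk_centered0 /M le_min; apply/andP; split.
    have := H2 0 0%N n j (lexx _) jn; rewrite mulr0 addr0 => /le_trans; apply.
    by rewrite lerDr.
  have := H2 l 0%N n j l0 jn; move=> /le_trans; apply.
  by rewrite lerD2r lerDr.
- move=> j jk; rewrite walk_centered0.
  have := H1 0 0%N k j (lexx _) jk; rewrite mulr0 addr0 => /le_trans; apply.
  by rewrite /Q; have := B20 0 0 k; have := B10 0 (n - k) k; lra.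
- move=> j jk; rewrite walk_centered0.
  have := H2 0 0%N k j (lexx _) jk; rewrite mulr0 addr0 => /le_trans; apply.
  by rewrite /Q; have := B10 0 0 k; have := B10 0 (n - k) k; lra.
rewrite lerD2l; apply: lerD.
  rewrite lerD2l ler_pM2l//; apply: ler_wpM2l; first by rewrite divr_ge0.
  by rewrite /M ge_min lexx.
rewrite ler_pM2l// ge_max; apply/andP; split; first by rewrite addr_ge0.
have : M <= Ml + 4 * l by rewrite /M ge_min lexx orbT.
by have := lk; lra.
Qed.

End deterministic.

Let pt n (p : bool * 'I_n.+1) w : R * R :=
  if p.1 then walk Z1 p.2 w else walk Z2 p.2 w.

(** The diameter as a maximum over a finite type: it bounds the distances, and it shows that the
    diameter is measurable. *)
Let maxdist n w : R := \big[Num.max/0]_p \big[Num.max/0]_q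
  enorm (pt (n := n) p w - pt (n := n) q w).

Let points_pt n w x : points n w x <-> exists p, x = pt (n := n) p w.
Proof.
split=> [[[j jn <-]|[j jn <-]]|[[[] j] ->]].
- by exists (true, Ordinal (jn : (j < n.+1)%N)).
- by exists (false, Ordinal (jn : (j < n.+1)%N)).
- by left; exists j => //=; rewrite -ltnS.
- by right; exists j => //=; rewrite -ltnS.
Qed.

Let le_maxdist n w x y : points n w x -> points n w y ->
  enorm (x - y) <= maxdist n w.
Proof.
move=> /points_pt[p ->] /points_pt[q ->]; rewrite /maxdist.
apply: le_trans (le_bigmax _ _ p).
exact: (le_bigmax _ (fun q => enorm (pt p w - pt q w)) q).
Qed.

Let points0 n w : points n w 0.
Proof. by left; exists 0%N => //; rewrite /walk big_ord0. Qed.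

Let le_D n w x y : points n w x -> points n w y -> enorm (x - y) <= D n w.
Proof. by move=> hx hy; apply: le_diameter_hull hx hy; exact: le_maxdist. Qed.

Let D_le n w c : (forall x y, points n w x -> points n w y ->
  enorm (x - y) <= c) -> D n w <= c.
Proof. by apply: diameter_hull_le; exists 0; exact: points0. Qed.

Let D_maxdist n w : D n w = maxdist n w.
Proof.
apply/eqP; rewrite eq_le; apply/andP; split; first exact/D_le/le_maxdist.
have D0 : 0 <= D n w.
  by apply: le_trans (le_D (points0 n w) (points0 n w)); exact: enorm_ge0.
apply: bigmax_le => // p _; apply: bigmax_le => // q _.
by apply: le_D; apply/points_pt; eexists.
Qed.

Lemma measurable_bigmax (I : Type) (s : seq I) (F : I -> T -> R) :
  (forall i, measurable_fun setT (F i)) ->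
  measurable_fun setT (fun w => \big[Num.max/0]_(i <- s) F i w).
Proof.
move=> mF; elim: s => [|i s IHs].
  by under eq_fun do rewrite big_nil; exact: measurable_cst.
by under eq_fun do rewrite big_cons; exact: measurable_maxr.
Qed.

Lemma fst_walk (Z : nat -> T -> R * R) n w :
  (walk Z n w).1 = \sum_(i < n) (Z i w).1.
Proof. exact: (big_morph fst). Qed.

Lemma snd_walk (Z : nat -> T -> R * R) n w :
  (walk Z n w).2 = \sum_(i < n) (Z i w).2.
Proof. exact: (big_morph snd). Qed.

Lemma measurable_walk (Z : nat -> {RV P >-> (R * R)%type}) n :
  measurable_fun setT (walk Z n).
Proof.
apply/measurable_fun_pairP; split.
  rewrite (_ : fst \o _ = fun w => \sum_(i < n) (Z i w).1).
    by apply: measurable_sum => i; exact: measurableT_comp.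
  by apply/funext => w; exact: fst_walk.
rewrite (_ : snd \o _ = fun w => \sum_(i < n) (Z i w).2).
  by apply: measurable_sum => i; exact: measurableT_comp.
by apply/funext => w; exact: snd_walk.
Qed.

Let measurable_D n : measurable_fun setT (D n).
Proof.
rewrite (_ : D n = maxdist n); last by apply/funext => w; exact: D_maxdist.
rewrite /maxdist; apply: measurable_bigmax => p; apply: measurable_bigmax => q.
have mpt r : measurable_fun setT (pt (n := n) r).
  by rewrite /pt; case: r.1; exact: measurable_walk.
apply: measurableT_comp; first exact: measurable_enorm.
apply/measurable_fun_pairP; split => /=; apply: measurable_funB;
  exact: measurableT_comp.
Qed.

Lemma fst_walk_Lfun2 n : (fun w => (walk Z1 n w).1) \in Lfun P 2%:E.
Proof.
under eq_fun do rewrite fst_walk; apply: Lfun2_sum => i.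
apply: (@identically_distributed_Lfun2 _ _ _ _ _ _ _ Z1 (proj2 iidZ1) _ 0%N i
  measurable_fst); exact: fst_Lfun2.
Qed.

Lemma snd_walk_Lfun2 n : (fun w => (walk Z1 n w).2) \in Lfun P 2%:E.
Proof.
under eq_fun do rewrite snd_walk; apply: Lfun2_sum => i.
apply: (@identically_distributed_Lfun2 _ _ _ _ _ _ _ Z1 (proj2 iidZ1) _ 0%N i
  measurable_snd); exact: snd_Lfun2.
Qed.

Let X_Lfun2 n : X n \in Lfun P 2%:E.
Proof.
rewrite /X /dot; apply: Lfun2D.
  by under eq_fun do rewrite mulrC; apply: Lfun2_scale; exact: fst_walk_Lfun2.
by under eq_fun do rewrite mulrC; apply: Lfun2_scale; exact: snd_walk_Lfun2.
Qed.

Let dot_vexpectation n : dot (vexpectation P (walk Z1 n)) e = \int[P]_w X n w.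
Proof.
have i1 := Lfun2_integrable (fst_walk_Lfun2 n).
have i2 := Lfun2_integrable (snd_walk_Lfun2 n).
rewrite /X /dot; under eq_Rintegral do rewrite mulrC [_ * e.2]mulrC.
rewrite RintegralD//; try exact: Rintegrable_scale.
by rewrite !RintegralZl// /vexpectation/= unlock mulrC [_ * e.2]mulrC.
Qed.

(** The pair $(S_0, S_n^{(1)})$ is among the points, and a projection on [e] is no longer than the
    vector. *)
Let G_ge0 n w : 0 <= G n w.
Proof.
rewrite /G subr_ge0.
apply: le_trans (le_D (x := walk Z1 n w) (y := 0) _ (points0 n w)).
  rewrite subr0 /X; apply: le_trans (ler_norm _) _.
  by rewrite -[leRHS]mulr1 -e1 ler_dot.
by left; exists n => //=.
Qed.

Let H n k l w : R :=
  (2 * (2 * walk_excess Z1 0 (n - k) k w +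
        (walk_excess Z1 0 0 k w + walk_excess Z2 0 0 k w)) +
   2 * (k%:R / n%:R) * (walk_excess Z1 0 0 n w + walk_excess Z2 0 0 n w)) +
  6 * (walk_excess Z1 l 0 n w + walk_excess Z2 l 0 n w).

Let G_le n k l w : (0 < n)%N -> (k <= n)%N -> 0 <= l ->
  4 * l <= k%:R * dlt / 6 -> G n w <= H n k l w.
Proof.
move=> n0 kn l0 lk; rewrite /G lerBlDl /H -[2 * (k%:R / _) * _]mulrA.
by apply: D_le => x y; exact: points_dist_le.
Qed.

Let B1_Lfun2 l a k : walk_excess Z1 l a k \in Lfun P 2%:E.
Proof. exact: walk_excess_Lfun2. Qed.

Let B2_Lfun2 l a k : walk_excess Z2 l a k \in Lfun P 2%:E.
Proof. exact: walk_excess_Lfun2. Qed.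

Let H_Lfun2 n k l : H n k l \in Lfun P 2%:E.
Proof. by rewrite /H; do ?[apply: Lfun2D|apply: Lfun2_scale]. Qed.

Let G_Lfun2 n : (0 < n)%N -> G n \in Lfun P 2%:E.
Proof.
(* The choice [k = n], [l = 0] satisfies the conditions of [G_le] for every positive [n]. *)
move=> n0; apply: (le_Lfun2 _ _ (H_Lfun2 n n 0)) => [|w].
  by apply: measurable_funB => //; exact: (Lfun2_measurable (X_Lfun2 n)).
rewrite ger0_norm// (le_trans _ (ler_norm _))//; apply: G_le => //.
by rewrite mulr0 divr_ge0// mulr_ge0// ltW.
Qed.

Let G_sqr_small eta : 0 < eta -> exists n0, forall n, (n0 <= n)%N ->
  \int[P]_w (G n w ^+ 2) <= n%:R * eta.
Proof.
move=> eta0.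
have [s1 [s10 hs1]] := walk_excess0_sqr iidZ1 Z1_sq.
have [s2 [s20 hs2]] := walk_excess0_sqr iidZ2 Z2_sq.
pose s := s1 + s2.
have s0 : 0 <= s by rewrite addr_ge0.
have b1 a k : \int[P]_w (walk_excess Z1 0 a k w ^+ 2) <= k%:R * s.
  by apply: (le_trans (hs1 a k)); rewrite ler_wpM2l// lerDl.
have b2 a k : \int[P]_w (walk_excess Z2 0 a k w ^+ 2) <= k%:R * s.
  by apply: (le_trans (hs2 a k)); rewrite ler_wpM2l// lerDr.
(* The terms at level 0 will add up to at most [320 * s * n / q]; this [q] makes that at most
   [n eta / 2]. *)
pose q := (Num.truncn (640 * s / eta)).+1.
have q0 : 0 < q%:R :> R by rewrite ltr0n.
have q1 : 1 <= q%:R :> R by rewrite ler1n.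
have sq : 320 * s <= q%:R * eta / 2.
  have : 640 * s / eta <= q%:R by exact: ltW (truncnS_gt _).
  by rewrite ler_pdivrMr//; lra.
(* With [n <= 2 k q] this gives [4 c n = dlt n / (12 q) <= k dlt / 6], as [G_le] requires of the
   level [l = c n]. *)
pose c := dlt / (48 * q%:R).
have c0 : 0 < c by rewrite divr_gt0// mulr_gt0.
(* The two overshoot terms enter with the total factor [2 * 6 ^ 2 * 2 * 2 = 288], leaving
   [n eta / 2]. *)
have eta1 : 0 < eta / 576 by lra.
have [n1 hn1] := walk_excess_sqr_small iidZ1 Z1_sq c0 eta1.
have [n2 hn2] := walk_excess_sqr_small iidZ2 Z2_sq c0 eta1.
exists (maxn q (maxn n1 n2)) => n.
rewrite !geq_max => /and3P[qn /hn1 l1 /hn2 l2].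
have n0 : (0 < n)%N by exact: leq_trans qn.
pose k := (n %/ q)%N.
have kqn : (k * q <= n)%N by exact: leq_divM.
(* As [n >= q], the quotient [k] is positive, so the remainder is at most [k * q]. *)
have nkq : (n <= 2 * (k * q))%N.
  have k0 : (0 < k)%N by rewrite divn_gt0.
  rewrite {1}(divn_eq n q) -/k mul2n -addnn leq_add2l.
  by rewrite (leq_trans (ltnW (ltn_pmod n (ltn0Sn _))))// leq_pmull.
have kn : (k <= n)%N by exact: leq_div.
have kqR : k%:R * q%:R <= n%:R :> R by rewrite -natrM ler_nat.
have nkqR : n%:R <= 2 * (k%:R * q%:R) :> R by rewrite -!natrM ler_nat.
have nR0 : 0 < n%:R :> R by rewrite ltr0n.
have kR0 := ler0n R k.
have lk : 4 * (c * n%:R) <= k%:R * dlt / 6.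
  rewrite /c (_ : 4 * _ = dlt * n%:R / (12 * q%:R)); last first.
    by field; rewrite gt_eqF.
  rewrite ler_pdivrMr ?mulr_gt0//.
  by have := ler_wpM2l (ltW dlt0) nkqR; lra.
have l0 : 0 <= c * n%:R by rewrite mulr_ge0// ltW.
set r := k%:R / n%:R : R.
have r0 : 0 <= r by rewrite divr_ge0.
have rq : r * q%:R <= 1 by rewrite /r mulrAC ler_pdivrMr// mul1r.
have HL a j : (fun w => walk_excess Z1 a 0 j w + walk_excess Z2 a 0 j w) \in
  Lfun P 2%:E by exact: Lfun2D.
have h1 : \int[P]_w (H n k (c * n%:R) w ^+ 2) <=
  2 * (2 * (2 ^+ 2 * (2 * (2 ^+ 2 * (k%:R * s) + 2 * (k%:R * s + k%:R * s))) +
            (2 * r) ^+ 2 * (2 * (n%:R * s + n%:R * s))) +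
       6 ^+ 2 * (2 * (n%:R * (eta / 576) + n%:R * (eta / 576)))).
  rewrite /H -/r; apply: sqr_addD_le.
  - by do ?[apply: Lfun2D|apply: Lfun2_scale].
  - exact: Lfun2_scale.
  - apply: sqr_addD_le; [by do ?[apply: Lfun2D|apply: Lfun2_scale]|
      exact: Lfun2_scale| |].
      apply: sqr_scale_le; first by do ?[apply: Lfun2D|apply: Lfun2_scale].
      apply: sqr_addD_le; [exact: Lfun2_scale|exact: HL| |].
        exact: sqr_scale_le.
      exact: sqr_addD_le.
    by apply: sqr_scale_le => //; exact: sqr_addD_le.
  - by apply: sqr_scale_le => //; exact: sqr_addD_le.
have h2 : \int[P]_w (G n w ^+ 2) <= \int[P]_w (H n k (c * n%:R) w ^+ 2).
  apply: le_Rintegral => //; first exact: (Lfun2_sqr (G_Lfun2 n0)).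
    exact: Lfun2_sqr.
  move=> w _; have := G_ge0 n w; have := G_le w n0 kn l0 lk; nra.
apply: (le_trans h2); apply: (le_trans h1).
have e1' : k%:R = r * n%:R by rewrite /r divfK// gt_eqF.
have h3 : 256 * (k%:R * s) + 64 * (r ^+ 2 * (n%:R * s)) <= n%:R * eta / 2.
  have r1 : r <= 1.
    by apply: le_trans rq; rewrite -[leLHS]mulr1 ler_wpM2l.
  have r2 : r ^+ 2 <= r by rewrite expr2 -[leRHS]mulr1 ler_wpM2l.
  have ns0 : 0 <= n%:R * s by rewrite mulr_ge0.
  have h4 := ler_wpM2r ns0 r2.
  apply: (@le_trans _ _ (r * n%:R * (320 * s))); first by rewrite e1'; lra.
  apply: (@le_trans _ _ (r * n%:R * (q%:R * eta / 2))).
    by apply: ler_wpM2l => //; rewrite mulr_ge0.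
  rewrite (_ : _ * _ = r * q%:R * (n%:R * eta / 2)); last by ring.
  by rewrite -[leRHS]mul1r ler_wpM2r// divr_ge0// mulr_ge0// ltW.
by move: h3; lra.
Qed.

Let D_Lfun2 n : (0 < n)%N -> D n \in Lfun P 2%:E.
Proof.
move=> n0; have -> : D n = fun w => G n w + X n w.
  by apply/funext => w; rewrite /G subrK.
by apply: Lfun2D => //; exact: G_Lfun2.
Qed.

(** The quantity to be normalised is exactly the centered [G n], so its second moment is at most
    that of [G n]. *)
Let D_centered n w : (0 < n)%N ->
  D n w - fine 'E_P[D n] - dot (walk Z1 n w - vexpectation P (walk Z1 n)) e =
  G n w - \int[P]_x G n x.
Proof.
move=> n0; rewrite dotBl dot_vexpectation -/(X n w).
have -> : \int[P]_x G n x = \int[P]_x D n x - \int[P]_x X n x.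
  by rewrite RintegralB//; apply: Lfun2_integrable => //; exact: D_Lfun2.
have -> : fine 'E_P[D n] = \int[P]_x D n x by rewrite unlock.
by rewrite /G; ring.
Qed.

Lemma walks_diameter_centered_cvg : converges_in_L2 P
  (fun n w => (Num.sqrt n%:R)^-1 *
    `| D n w - fine 'E_P[D n]
       - dot (walk Z1 n w - vexpectation P (walk Z1 n)) e |)
  (cst 0).
Proof.
set F := fun n w => _.
(* At [n = 0] the inverse of 0 is 0 by convention; the bounds on [G n] apply to positive [n]. *)
have F0 w : F 0%N w = 0 by rewrite /F sqrtr0 invr0 mul0r.
have FE n : (0 < n)%N ->
    F n = fun w => (Num.sqrt n%:R)^-1 * `| G n w - \int[P]_x G n x |.
  by move=> n0; apply/funext => w; rewrite /F D_centered.
have Gc n : (0 < n)%N -> (fun w => G n w - \int[P]_x G n x) \in Lfun P 2%:E.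
  by move=> n0; apply: Lfun2B; [exact: G_Lfun2|exact: Lfun2_cst].
have F2 n : F n \in Lfun P 2%:E.
  case: n => [|n].
    by rewrite (_ : F 0%N = fun=> 0); [exact: Lfun2_cst|exact/funext].
  rewrite FE//; apply: Lfun2_scale.
  apply: (le_Lfun2 _ _ (Gc n.+1 isT)) => [|w]; last by rewrite normr_id.
  by apply: measurableT_comp => //; exact: (Lfun2_measurable (Gc n.+1 isT)).
split=> //; split; first exact: (Lfun2_cst P 0).
under eq_fun do under eq_fun do rewrite subr0.
apply: Lnorm2_cvg0 => // eta eta0; have [n0 hn0] := G_sqr_small eta0.
exists n0.+1 => n nn0; have npos : (0 < n)%N by exact: leq_trans nn0.
rewrite FE//; under eq_Rintegral do
  rewrite exprMn exprVn sqr_sqrtr// real_normK ?num_real//.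
rewrite RintegralZl//; last exact: (Lfun2_sqr (Gc n npos)).
rewrite ler_pdivrMl ?ltr0n//; apply: le_trans (hn0 n (ltnW nn0)).
exact: (centered_sqr_le (G_Lfun2 npos)).
Qed.

End two_walks.

Unset Implicit Arguments.

Theorem theorem2p3 (d : measure_display) (T : measurableType d) (R : realType)
    (P : probability T R) (Z1 Z2 : nat -> {RV P >-> (R * R)%type})
    (iidZ1 : iid Z1) (iidZ2 : iid Z2)
    (indepZ1Z2 : independent_families Z1 Z2)
    (Z1_sq : ('E_P[fun w => (enorm (Z1 0%N w) ^+ 2)%R] < +oo)%E)
    (Z2_sq : ('E_P[fun w => (enorm (Z2 0%N w) ^+ 2)%R] < +oo)%E) :
  let mu1 := vexpectation P (Z1 0%N) in
  let mu2 := vexpectation P (Z2 0%N) in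
  let S1 := walk Z1 in
  let D := walks_diameter Z1 Z2 in
  forall (mu_neq0 : ~ [set mu1; mu2; mu1 - mu2] 0)
    (mu1_max : Num.max (enorm mu2) (enorm (mu1 - mu2)) < enorm mu1)
    (theta1 : R) (theta1_bounds : 0 <= theta1 < 2 * pi)
    (theta1E : mu1 = enorm mu1 *: unit_dir theta1),
  converges_in_L2 P
    (fun n w => (Num.sqrt n%:R)^-1 *
      `| D n w - fine 'E_P[D n]
         - dot (S1 n w - vexpectation P (S1 n)) (unit_dir theta1) |)
    (cst 0).
Proof.
move=> mu1 mu2 S1 D _ mu1_max theta1 _ theta1E.
have e1 : enorm (unit_dir theta1) = 1.
  by rewrite /enorm /dot /= -!expr2 cos2Dsin2 sqrtr1.
(* The gap [dlt] is [enorm mu1 - c]: positive by strict maximality, and at most [enorm mu1] because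
   [c >= 0]. *)
pose c := Num.max (enorm mu2) (enorm (mu1 - mu2)).
have c0 : 0 <= c by rewrite le_max enorm_ge0.
apply: (@walks_diameter_centered_cvg _ _ _ P Z1 Z2 iidZ1 iidZ2 Z1_sq Z2_sq
  (enorm mu1) (enorm mu1 - c) (unit_dir theta1) e1 theta1E).
- by rewrite subr_gt0.
- by rewrite gerBl.
- by rewrite subKr le_max lexx.
- by rewrite subKr le_max lexx orbT.
Qed.
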